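(* For a subsequence $(k_n)$ of $\mathbb{N}$ the following are equivalent: (i) $(k_n)$ is Wiener extremal. (ii) For every complex Hilbert space $H$, every linear contraction $T$ on $H$ and every $x\in H\setminus\{0\}$, if $$\lim_{N\to\infty}\frac1N\sum_{n=1}^N|(T^{k_n}x|x)|^2=\|x\|^4,$$ then $x$ is an eigenvector of $T$ with unimodular eigenvalue.
   Context: $\mathbb{N}=\{1,2,\dots\}$; a subsequence $(k_n)$ of $\mathbb{N}$ is a function $k:\mathbb{N}\to\mathbb{N}$ that is strictly increasing for sufficiently large indices. For a Borel probability measure $\mu$ on the unit circle $\mathbb{T}$, $\widehat\mu(k)=\int_{\mathbb{T}}z^k\,\mathrm{d}\mu(z)$. The subsequence $(k_n)$ is called Wiener extremal if every Borel probability measure $\mu$ on $\mathbb{T}$ with $\lim_{N\to\infty}\frac1N\sum_{n=1}^N|\widehat\mu(k_n)|^2=1$ is a Dirac measure. $(\cdot|\cdot)$ denotes the inner product; a contraction is an operator of norm at most $1$; unimodular means of absolute value $1$. *)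

(* Defs.v *)
From HB Require Import structures.
From mathcomp Require Import all_boot all_order all_algebra.
From mathcomp Require Import complex.
From mathcomp Require Import all_classical all_reals all_analysis.
Set Implicit Arguments.
Unset Strict Implicit.
Unset Printing Implicit Defensive.
Import Order.TTheory GRing.Theory Num.Theory.
Import numFieldNormedType.Exports.
Local Open Scope classical_set_scope.
Local Open Scope ring_scope.
Local Open Scope complex_scope.

(* [R[i]] carries its topology only as the regular module [R[i]^o]. *)
Definition unit_circle (R : realType) : set R[i]^o := [set z | `|z| = 1].

Definition circle (R : realType) : Type := set_type (@unit_circle R).

(* The subspace topology inherited from the complex plane. *)
HB.instance Definition _ (R : realType) :=
  Topological.on (circle R).

Definition circle1 (R : realType) : circle R :=
  exist _ (1 : R[i]^o) (mem_set (normr1 _ : unit_circle 1)).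

HB.instance Definition _ (R : realType) :=
  isPointed.Build (circle R) (circle1 R).

Definition borel_circle (R : realType) :=
  g_sigma_algebraType (@open (circle R)).

Definition cintegral (d : measure_display) (T : measurableType d)
    (R : realType) (mu : {measure set T -> \bar R}) (f : T -> R[i]) : R[i] :=
  (\int[mu]_t complex.Re (f t))%R +i* (\int[mu]_t complex.Im (f t))%R.

Definition fourier_coef (R : realType)
    (mu : probability (borel_circle R) R) (k : nat) : R[i] :=
  cintegral mu (fun z : borel_circle R => set_val z ^+ k).

Definition is_dirac (R : realType) (mu : probability (borel_circle R) R) :=
  exists z : borel_circle R, forall A, measurable A -> mu A = \d_z A.

(* The index set is {1, 2, ...}: the value [k 0] is irrelevant throughout. *)
Definition nat_subsequence (k : nat -> nat) :=
  (forall n, (0 < n)%N -> (0 < k n)%N) /\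
  \forall n0 \near \oo, forall m n, (n0 <= m < n)%N -> (k m < k n)%N.

Definition cesaro_mean (R : realType) (u : nat -> R[i]) (N : nat) : R[i]^o :=
  N%:R^-1 * \sum_(1 <= n < N.+1) u n.

Definition wiener_extremal (R : realType) (k : nat -> nat) :=
  forall mu : probability (borel_circle R) R,
    cesaro_mean (fun n => `|fourier_coef mu (k n)| ^+ 2) @ \oo
      --> (1 : R[i]^o) ->
    is_dirac mu.

(* [dot] makes the Banach space [H] a Hilbert space. *)
Definition induces_norm (R : realType) (H : completeNormedModType R[i])
    (dot : {dot H for Num.conj}) :=
  forall x : H, `|x| ^+ 2 = dot x x.

Definition linear_contraction (R : realType) (H : completeNormedModType R[i])
    (T : {linear H -> H}) :=
  forall x : H, `|T x| <= `|x|.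

Definition unimodular_eigenvector (R : realType)
    (H : completeNormedModType R[i]) (T : {linear H -> H}) (x : H) :=
  x != 0 /\ exists2 lambda : R[i], `|lambda| = 1 & T x = lambda *: x.

(* Main.v *)
(* (i) => (ii): Telescoping the norms of the orbit sums [x + S x + ... + S^m x] of the
   contractions [S = w T], [|w| = 1], shows that the Fejer means attached to the
   sequence [(T^n x | x)] are nonnegative. They weight the roots of unity by
   discrete measures whose k-th Fourier coefficients tend to [(T^k x | x)]; a limit
   of their distribution functions yields, through its quantile function, a
   probability measure with Fourier coefficients [(T^k x | x) / |x|^2]. If that
   measure is a Dirac measure at [lambda], then [(T x | x) = lambda |x|^2], hence
   [T x = lambda x] by expanding [|T x - lambda x|^2].

   (ii) => (i): Complete the polynomials for the semi-definite form
   [\int p(z) conj(q(z)) dmu]; multiplication by the variable extends to an isometry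
   [T] of the completion, with [(T^k 1 | 1)] the k-th Fourier coefficient of [mu]. If
   [T 1 = lambda 1], then [\int |z - lambda|^2 dmu = 0], so [mu] is Dirac at [lambda]. *)
From HB Require Import structures.
Require Import Defs.
From mathcomp Require Import all_boot all_order all_algebra.
From mathcomp Require Import complex ring lra.
From mathcomp Require Import all_classical all_reals all_analysis.
From mathcomp Require Import measurable_realfun.
Import Order.TTheory GRing.Theory Num.Theory.
Import numFieldNormedType.Exports.
Local Open Scope classical_set_scope.
Local Open Scope ring_scope.
Local Open Scope complex_scope.

(** * Limits of positive functionals on the unit interval *)

(** The Cesaro hypothesis is never analysed: both directions carry it over term by term, so the work
    is a dictionary between orbits of contractions and measures on the circle. The delicate half is
    to obtain a measure from a contraction that need not be normal and so has no spectral measure;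
    positivity of the Fejer means stands in for a unitary dilation. Sampling the mean of order n + 1
    at 2(n + 1) roots of unity, rather than integrating it, keeps every approximating law a finite
    sum. Nothing is lost for a frequency k <= n: the frequencies k - i and k + i that occur, with 1
    <= i <= n + 1, stay strictly between -2(n + 1) and 2(n + 1), so none is aliased. The circle is
    cut open to [0, 1), where distribution functions make sense. Only cosines and sines are tested,
    and these are Lipschitz, so the jumps of the limiting distribution function do no harm. *)

Lemma bounded_cvg_ultra (R : realType) (U : set_system nat) (u : nat -> R)
    (a b : R) : UltraFilter U -> (forall n, a <= u n <= b) ->
  exists l : R, u @ U --> l.
Proof.
move=> UU uab; have : compact `[a, b] by exact: segment_compact.
have FA : U (u @^-1` `[a, b]) by apply: filterE => n; rewrite /= in_itv /= uab.
move=> /(_ (u @ U) _ FA)[l [_ cl_l]].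
exists l => A lA; have [//|UnA] := in_ultra_setVsetC (u @^-1` A) UU.
by have [x [nAx Ax]] := cl_l (~` A) A UnA lA.
Qed.

Lemma cvg_sum_ord (R : realType) (T : Type) (F : set_system T) (FF : Filter F)
    (m : nat) (u : nat -> T -> R) (l : nat -> R) :
  (forall j, u j x @[x --> F] --> l j) ->
  \sum_(j < m) u j x @[x --> F] --> \sum_(j < m) l j.
Proof.
move=> ul; elim: m => [|m IH].
  by under eq_fun do rewrite big_ord0; rewrite big_ord0; exact: cvg_cst.
by under eq_fun do rewrite big_ord_recr; rewrite big_ord_recr; exact: cvgD.
Qed.

(* If [P j] decides whether the grid point [(j + 1) / m] lies below [y], the sum
   telescopes to [f] at the last grid point below [y]. *)
Lemma step_approx (R : realType) (f : R -> R) (C y : R) (m : nat)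
    (P : nat -> bool) :
  (0 < m)%N -> (forall x z, `|f x - f z| <= C * `|x - z|) -> 0 <= y <= 1 ->
  (forall j, (j < m)%N -> P j -> j.+1%:R / m%:R <= y) ->
  (forall j, (j < m)%N -> ~~ P j -> y <= j.+1%:R / m%:R) ->
  `|f y - (f 0 + \sum_(j < m)
      (f (j.+1%:R / m%:R) - f (j%:R / m%:R)) * (P j)%:R)| <= C / m%:R.
Proof.
move=> m0 fC /andP[y0 y1] Ple Pge.
have m0' : 0 < m%:R :> R by rewrite ltr0n.
have C0 : 0 <= C by have := fC 1 0; rewrite subr0 normr1 mulr1; apply: le_trans.
(* [J] is the first index at which [P] fails, or [m] if there is none. Both hypotheses on [P] are
   weak inequalities, so y lies between J / m and (J + 1) / m whatever [P] says at a grid point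
   equal to y. *)
have exJ : exists J, (J == m) || ~~ P J by exists m; rewrite eqxx.
case: (ex_minnP exJ) => J PJ minJ.
have Jm : (J <= m)%N by apply: minJ; rewrite eqxx.
have PltJ j : (j < J)%N -> P j.
  move=> jJ; apply: contraTT jJ => nPj; rewrite -leqNgt; apply: minJ.
  by rewrite nPj orbT.
have Jy : J%:R / m%:R <= y.
  case: J Jm PltJ {minJ PJ} => [|J] Jm PltJ; first by rewrite mul0r.
  by apply: Ple => //; apply: PltJ.
have yJ : y <= J.+1%:R / m%:R.
  case/orP: PJ => [/eqP ->|nPJ].
    by rewrite (le_trans y1)// ler_pdivlMr// mul1r ler_nat.
  have [JltM|] := ltnP J m; first exact: Pge.
  by move=> mJ; rewrite (le_trans y1)// ler_pdivlMr// mul1r ler_nat leqW.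
have PgeJ j : (J <= j < m)%N -> ~~ P j.
  case/andP; rewrite leq_eqVlt => /predU1P[<-|Jj] jm.
    by case/orP: PJ => // /eqP E; rewrite E ltnn in jm.
  apply/negP => /(Ple _ jm); apply/negP; rewrite -ltNge.
  by rewrite (le_lt_trans yJ)// ltr_pM2r ?invr_gt0// ltr_nat.
have -> : \sum_(j < m) (f (j.+1%:R / m%:R) - f (j%:R / m%:R)) * (P j)%:R
    = f (J%:R / m%:R) - f 0.
  rewrite -(big_mkord xpredT (fun j : nat =>
    (f (j.+1%:R / m%:R) - f (j%:R / m%:R)) * (P j)%:R)).
  rewrite (big_cat_nat (n := J))//= [X in _ + X]big_nat_cond.
  rewrite [X in _ + X]big1 ?addr0; last first.
    by move=> j /andP[/PgeJ/negbTE -> _]; rewrite mulr0.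
  rewrite [LHS]big_nat_cond.
  under eq_bigr => j /andP[/andP[_ /PltJ ->] _] do rewrite mulr1.
  rewrite -big_nat_cond (telescope_sumr (fun j : nat => f (j%:R / m%:R)))//.
  by rewrite mul0r.
rewrite addrCA subrr addr0 (le_trans (fC _ _))// ler_wpM2l//.
rewrite ger0_norm ?subr_ge0// lerBlDr (le_trans yJ)//.
by rewrite -natr1 mulrDl mul1r addrC.
Qed.

(** Measures the parameters t with F(a) <= t, for c = F(a) a value of a distribution function.
    Inside the support the half-line becomes [c, 1], a null set when c = 1. *)
Lemma uniform_prob_itvcy (R : realType) (c : R) : 0 <= c <= 1 ->
  uniform_prob (@ltr01 R) `[c, +oo[ = (1 - c)%:E.
Proof.
move=> /andP[c0 c1]; rewrite /uniform_prob integral_uniform_pdf.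
rewrite (_ : _ `&` _ = `[c, 1]%classic); last first.
  apply/seteqP; split => x /=; rewrite !in_itv/= andbT.
    by move=> [-> /andP[]].
  by move=> /andP[cx ->]; rewrite cx (le_trans c0 cx).
rewrite (eq_integral (fun=> 1%:E)); last first.
  move=> x; rewrite inE/= in_itv/= => /andP[cx x1].
  by rewrite /uniform_pdf x1 (le_trans c0 cx)/= subr0 invr1.
rewrite integral_cst//= mul1e lebesgue_measure_itv/= lte_fin EFinB.
by move: c1; rewrite le_eqVlt => /predU1P[->|->//]; rewrite ltxx subee.
Qed.

Lemma bounded_integrable d (T : measurableType d) (R : realType)
    (P : probability T R) (f : T -> R) (M : R) :
  measurable_fun setT f -> (forall x, `|f x| <= M) ->
  P.-integrable setT (EFin \o f).
Proof.
move=> mf fM; apply: measurable_bounded_integrable => //.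
  by apply: (le_lt_trans (probability_le1 P measurableT)); rewrite ltry.
exists M; split; first exact: num_real.
by move=> r Mr x _; apply: le_trans (fM x) (ltW Mr).
Qed.

Lemma Rintegral_cst_probability d (T : measurableType d) (R : realType)
    (P : probability T R) (c : R) : \int[P]_x c = c.
Proof. by rewrite Rintegral_cst//= (@probability_setT _ _ _ P) mulr1. Qed.

Lemma Rintegral_sum_ord d (T : measurableType d) (R : realType)
    (P : {measure set T -> \bar R}) (m : nat) (f : nat -> T -> R) :
  (forall j, P.-integrable setT (EFin \o f j)) ->
  P.-integrable setT (EFin \o (fun x => \sum_(j < m) f j x)) /\
  \int[P]_x (\sum_(j < m) f j x) = \sum_(j < m) \int[P]_x f j x.
Proof.
move=> intf; elim: m => [|m [IHi IHe]].
  under [in X in X /\ _]eq_fun do rewrite big_ord0.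
  under eq_Rintegral do rewrite big_ord0.
  by rewrite big_ord0 Rintegral_cst// mul0r; split => //; exact: integrable0.
under [in X in X /\ _]eq_fun do rewrite big_ord_recr.
under eq_Rintegral do rewrite big_ord_recr/=.
rewrite big_ord_recr/= -IHe RintegralD//; split => //.
exact: (integrableD measurableT IHi (intf m)).
Qed.

Section quantile.
Context (R : realType) (E : nat -> (R -> R) -> R).
Hypothesis E_lin : forall n a f g,
  E n (fun x => a * f x + g x) = a * E n f + E n g.
Hypothesis E_ge0 : forall n (f : R -> R), (forall x : R, 0 <= x < 1 -> 0 <= f x) -> 0 <= E n f.
Hypothesis E_1 : forall n, E n (fun=> 1) = 1.

Lemma functional0 n : E n (fun=> 0) = 0.
Proof.
have := E_lin n (-1) (fun=> 0) (fun=> 0).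
by under eq_fun do rewrite mulr0 addr0; rewrite mulN1r addNr.
Qed.

Lemma functional_le n (f g : R -> R) : (forall x : R, 0 <= x < 1 -> f x <= g x) -> E n f <= E n g.
Proof.
move=> fg; rewrite -subr_ge0 addrC -mulN1r -E_lin; apply: E_ge0 => x x01.
by rewrite mulN1r addrC subr_ge0 fg.
Qed.

Lemma functional_sum n (c : R) (m : nat) (a : nat -> R) (f : nat -> R -> R) :
  E n (fun x => c + \sum_(j < m) a j * f j x) = c + \sum_(j < m) a j * E n (f j).
Proof.
elim: m => [|m IH].
  under eq_fun do rewrite big_ord0 addr0.
  rewrite big_ord0 addr0 -[RHS]addr0 -(functional0 n) -[in RHS](mulr1 c) -{1}(E_1 n).
  by rewrite -E_lin; congr E; apply/funext => x; rewrite mulr1 addr0.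
under eq_fun do rewrite big_ord_recr/= addrA addrC.
by rewrite E_lin IH big_ord_recr/= [LHS]addrC [RHS]addrA.
Qed.

(** The inequality is strict so that 1 - [cdf n c] is the value of [E n] at the indicator of [c,
    +oo[, the kind of step that [step_approx] sums. *)
Let cdf n c := E n (fun x => (x < c)%R%:R).

Let cdf01 n c : 0 <= cdf n c <= 1.
Proof.
apply/andP; split; first by apply: E_ge0.
by rewrite -(E_1 n); apply: functional_le => x _; rewrite lern1 leq_b1.
Qed.

(* An ultrafilter makes the distribution functions converge at every point, which
   replaces Helly's selection theorem; the limiting law is that of the quantile
   function of the limit. *)
Lemma limit_quantile : exists Q : R -> R, measurable_fun setT Q /\
  forall (f : R -> R) (C l : R), continuous f ->
    (forall x y, `|f x - f y| <= C * `|x - y|) -> E n f @[n --> \oo] --> l ->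
    \int[uniform_prob (@ltr01 R)]_t f (Q t) = l.
Proof.
have [U [UU sub]] := @ultraFilterLemma nat \oo _.
have cvF c : exists l : R, cdf n c @[n --> U] --> l.
  exact: bounded_cvg_ultra (fun n => cdf01 n c).
pose F c := projT1 (cid (cvF c)).
have FE c : cdf n c @[n --> U] --> F c by rewrite /F; case: cid.
have F01 c : 0 <= F c <= 1.
  apply/andP; split.
    by apply: (cvgr_to_ge (FE c)); near=> n; case/andP: (cdf01 n c).
  by apply: (cvgr_to_le (FE c)); near=> n; case/andP: (cdf01 n c).
have ndF : {homo F : x y / x <= y}.
  move=> x y xy; apply: (ler_cvg_to (FE x) (FE y)); near=> n.
  apply: functional_le => z _; rewrite ler_nat; case: (ltP z x) => //= zx.
  by rewrite (lt_le_trans zx xy).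
pose S t := [set x | 0 <= x <= 1 /\ F x <= t].
have ubS t : ubound (S t) 1 by move=> x [/andP[]].
(* For t below all values of [F] on [0, 1] the set is empty and its supremum is 0 by convention; as
   0 is the least point of [0, 1], [Q] stays in range and monotone. *)
pose Q t := sup (S t).
have Q01 t : 0 <= Q t <= 1.
  have [[x Sx]|S0] := pselect (S t !=set0).
    apply/andP; split.
      have [/andP[x0 _] _] := Sx; apply: (le_trans x0).
      by apply: ub_le_sup => //; exists 1.
    by apply: ge_sup => //; exists x.
  by rewrite /Q sup_out ?lexx ?ler01// => -[].
have ndQ : {homo Q : x y / x <= y}.
  move=> s t st; have [[x Sx]|S0] := pselect (S s !=set0).
    apply: ge_sup; first by exists x.
    move=> y [y01 Fy]; apply: ub_le_sup; first by exists 1.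
    by split => //; apply: le_trans st.
  by rewrite {1}/Q sup_out => [|[]//]; case/andP: (Q01 t).
have mQ : measurable_fun setT Q by apply: nondecreasing_measurable => //; exact: in2W.
exists Q; split => // f C l cf fC El.
have C0 : 0 <= C by have := fC 1 0; rewrite subr0 normr1 mulr1; apply: le_trans.
pose P := uniform_prob (@ltr01 R).
have fQM t : `|f (Q t)| <= `|f 0| + C.
  rewrite -lerBlDl (le_trans (lerB_dist _ _))// (le_trans (fC _ _))//.
  by rewrite subr0 ger0_norm ?ler_piMr//; case/andP: (Q01 t).
have mfQ : measurable_fun setT (f \o Q).
  by apply: measurableT_comp => //; exact: continuous_measurable_fun.
have ifQ : P.-integrable setT (EFin \o (f \o Q)) 
  by exact: (@bounded_integrable _ _ _ (uniform_prob (@ltr01 R)) (f \o Q) _ mfQ fQM).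
pose x m j : R := j%:R / m%:R.
pose D m j := f (x m j.+1) - f (x m j).
(* The error C / m does not depend on n, so for fixed m it survives the limit along [U], where only
   finitely many values of [cdf] are involved. *)
have approxE m n : (0 < m)%N ->
    `|E n f - (f 0 + \sum_(j < m) D m j * (1 - cdf n (x m j.+1)))| <= C / m%:R.
  move=> m0.
  have -> : f 0 + \sum_(j < m) D m j * (1 - cdf n (x m j.+1)) =
      E n (fun y => f 0 + \sum_(j < m) D m j * (x m j.+1 <= y)%R%:R).
    rewrite (functional_sum n (f 0) m (D m) (fun j y => (x m j.+1 <= y)%R%:R)).
    congr (_ + _); apply: eq_bigr => j _; congr (_ * _).
    transitivity (-1 * cdf n (x m j.+1) + E n (fun=> 1)).
      by rewrite E_1; ring.
    rewrite -E_lin; congr E; apply/funext => y.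
    by rewrite mulN1r leNgt; case: ltP => _; rewrite ?addNr// oppr0 add0r.
  rewrite ler_norml; apply/andP; split.
    rewrite lerBrDr addrC -lerBrDr opprK -[C / _]mulr1 -[X in _ * X](E_1 n) addrC -E_lin.
    apply: functional_le => y /andP[y0 y1].
    have := @step_approx R f C y m (fun j => x m j.+1 <= y) m0 fC.
    rewrite y0 ltW// => /(_ isT) H.
    have {}H := H (fun j _ h => h) (fun j _ h => ltW (eq_ind _ is_true h _ (esym (ltNge _ _)))).
    by move: H; rewrite ler_norml mulr1 => /andP[+ _]; rewrite /D /x; lra.
  rewrite lerBlDr -[C / _]mulr1 -[X in _ * X](E_1 n) -E_lin.
  apply: functional_le => y /andP[y0 y1].
  have := @step_approx R f C y m (fun j => x m j.+1 <= y) m0 fC.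
  rewrite y0 ltW// => /(_ isT) H.
  have {}H := H (fun j _ h => h) (fun j _ h => ltW (eq_ind _ is_true h _ (esym (ltNge _ _)))).
  by move: H; rewrite ler_norml mulr1 => /andP[_ +]; rewrite /D /x; lra.
have approxl m : (0 < m)%N ->
    `|l - (f 0 + \sum_(j < m) D m j * (1 - F (x m j.+1)))| <= C / m%:R.
  move=> m0.
  have cv : `|E n f - (f 0 + \sum_(j < m) D m j * (1 - cdf n (x m j.+1)))|
      @[n --> U] --> `|l - (f 0 + \sum_(j < m) D m j * (1 - F (x m j.+1)))|.
    apply: cvg_norm; apply: cvgB; first exact: (cvg_trans (cvg_app _ sub) El).
    apply: cvgD; first exact: cvg_cst.
    apply: (@cvg_sum_ord _ _ U _ m (fun j n => D m j * (1 - cdf n (x m j.+1)))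
      (fun j => D m j * (1 - F (x m j.+1)))) => j.
    apply: cvgMl_tmp; apply: cvgB; first exact: cvg_cst.
    exact: FE.
  by apply: (cvgr_to_le cv); near=> n; exact: approxE.
have approxQ m : (0 < m)%N ->
    `|\int[P]_t f (Q t) - (f 0 + \sum_(j < m) D m j * (1 - F (x m j.+1)))| <= C / m%:R.
  move=> m0; pose g j t : R := D m j * \1_(`[F (x m j.+1), +oo[) t.
  have ig j : P.-integrable setT (EFin \o g j).
    apply: (@bounded_integrable _ _ _ (uniform_prob (@ltr01 R)) _ `|D m j|).
      by apply: measurable_funM => //; exact: measurable_indic.
    by move=> t; rewrite /g normrM ler_piMr// indicE normr_nat lern1 leq_b1.
  have [isg sgE] := @Rintegral_sum_ord _ _ _ P m g ig.
  have -> : f 0 + \sum_(j < m) D m j * (1 - F (x m j.+1)) =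
     \int[P]_t (f 0 + \sum_(j < m) g j t).
    have ic : P.-integrable setT (EFin \o cst (f 0)).
      by apply: (@bounded_integrable _ _ _ (uniform_prob (@ltr01 R)) _ `|f 0|).
    rewrite RintegralD// sgE Rintegral_cst_probability.
    congr (_ + _); apply: eq_bigr => j _; rewrite RintegralZl//; last first.
      by apply: (@bounded_integrable _ _ _ (uniform_prob (@ltr01 R)) _ 1) => // t;
        rewrite indicE normr_nat lern1 leq_b1.
    congr (_ * _); rewrite /Rintegral integral_indic// setIT.
    exact: (esym (congr1 fine (uniform_prob_itvcy _ _ (F01 (x m j.+1))))).
  have ifs : P.-integrable setT (EFin \o (fun t => f 0 + \sum_(j < m) g j t)).
    exact: (integrableD measurableT (bounded_integrable _ _ _ (uniform_prob (@ltr01 R))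
      (cst (f 0)) `|f 0| (measurable_cst _) (fun=> lexx _)) isg).
  rewrite -RintegralB//.
  have iB := integrableB measurableT ifQ ifs.
  apply: (le_trans (le_normr_Rintegral _ _)) => //.
  have -> : C / m%:R = \int[P]_t (C / m%:R) by rewrite Rintegral_cst_probability.
  apply: le_Rintegral => //.
  - exact: (integrable_norm iB).
  - by apply: (@bounded_integrable _ _ _ (uniform_prob (@ltr01 R)) _ `|C / m%:R|).
  (* [F] is not known to be continuous from either side: F(c) <= t gives only c <= Q(t), and t <
     F(c) only Q(t) <= c. These weak inequalities are all that [step_approx] asks. *)
  move=> t _; have := @step_approx R f C (Q t) m (fun j => F (x m j.+1) <= t) m0 fC (Q01 t).
  rewrite (_ : \sum_(j < m) g j t = \sum_(j < m)
     (f (j.+1%:R / m%:R) - f (j%:R / m%:R)) * (F (x m j.+1) <= t)%R%:R); last first.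
    by apply: eq_bigr => j _; rewrite /g indicE mem_setE/= in_itv/= andbT.
  have m0' : 0 < m%:R :> R by rewrite ltr0n.
  apply => j jm.
    move=> Fxt; apply: ub_le_sup; first by exists 1.
    split => //; rewrite divr_ge0//= ler_pdivrMr// mul1r ler_nat//.
  rewrite -ltNge => Fxt; have [[z Sz]|S0] := pselect (S t !=set0).
    apply: ge_sup; first by exists z.
    move=> y [y01 Fy]; rewrite leNgt; apply/negP => /ltW/ndF.
    by rewrite leNgt (le_lt_trans Fy Fxt).
  by rewrite /Q sup_out => [|[]//]; rewrite divr_ge0.
apply/eqP; rewrite -subr_eq0 -normr_le0; apply/ler_addgt0Pl => e e0; rewrite addr0.
(* The approximations of the limit and of the integral cost C / m each, hence 2 C / e. *)
pose m := (Num.truncn (2 * C / e)).+1.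
have mC : C / m%:R + C / m%:R <= e.
  rewrite -mulrDl (_ : C + C = 2 * C); last by ring.
  rewrite ler_pdivrMr ?ltr0n// [leRHS]mulrC -ler_pdivrMr//.
  by rewrite ltW// truncnS_gt.
apply: le_trans mC; apply: le_trans (lerD (approxQ m isT) (approxl m isT)).
by rewrite [X in _ <= _ + X]distrC; exact: ler_distD.
Unshelve. all: by end_near. Qed.

End quantile.

(** * Fejer means and trigonometric moments *)

Definition expi (R : realType) (x : R) : R[i] := cos x +i* sin x.

Lemma expi0 (R : realType) : expi R 0 = 1.
Proof. by rewrite /expi cos0 sin0. Qed.

Lemma expiD (R : realType) (x y : R) : expi R (x + y) = expi R x * expi R y.
Proof.
rewrite /expi cosD sinD; apply/eqP; rewrite eq_complex /=.
by apply/andP; split; apply/eqP; ring.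
Qed.

Lemma expiN (R : realType) (x : R) : expi R (- x) = (expi R x)^*.
Proof. by rewrite /expi cosN sinN. Qed.

Lemma expiM_nat (R : realType) (x : R) n : expi R (n%:R * x) = expi R x ^+ n.
Proof.
elim: n => [|n IH]; first by rewrite mul0r expi0 expr0.
by rewrite exprSr -IH -expiD -natr1 mulrDl mul1r.
Qed.

Lemma norm_expi (R : realType) (x : R) : `|expi R x| = 1.
Proof. by rewrite normc_def /= cos2Dsin2 sqrtr1. Qed.

Lemma normc_le_add (R : rcfType) (z : R[i]) :
  `|z| <= (`|complex.Re z| + `|complex.Im z|)%:C.
Proof.
rewrite normc_def lecR -(@ler_pXn2r _ 2)// ?nnegrE ?sqrtr_ge0 ?addr_ge0//.
rewrite sqr_sqrtr ?addr_ge0 ?sqr_ge0// sqrrD !real_normK ?num_real//.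
by rewrite -addrA lerD2l lerDr mulrn_wge0// mulr_ge0.
Qed.

Lemma lipschitz_of_derive (R : realType) (f df : R -> R) (C : R) :
  (forall x : R, is_derive x 1 f (df x)) -> (forall x : R, `|df x| <= C) ->
  forall x y : R, `|f x - f y| <= C * `|x - y|.
Proof.
move=> fdf dfC x y; wlog xy : x y / x < y => [H|].
  case: (ltgtP x y) => [|yx|->]; first exact: H.
    by rewrite distrC [`|x - y|]distrC; exact: H.
  by rewrite !subrr normr0 mulr0.
have cf : {within `[x, y], continuous f}.
  apply: continuous_subspaceT => z.
  by apply: differentiable_continuous; apply/derivable1_diffP; case: (fdf z).
have [c _ E] := @MVT R f df x y xy (fun z _ => fdf z) cf.
by rewrite distrC E normrM [`|x - y|]distrC ler_wpM2r.
Qed.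

Lemma cos_scale_lipschitz (R : realType) (c x y : R) :
  `|cos (c * x) - cos (c * y)| <= `|c| * `|x - y|.
Proof.
apply: (lipschitz_of_derive R (fun x => cos (c * x)) (fun x => - sin (c * x) * c)).
  by move=> z; apply: is_derive_eq; rewrite /GRing.scale/=; ring.
by move=> z; rewrite normrM normrN ler_piMl// sin_max.
Qed.

Lemma sin_scale_lipschitz (R : realType) (c x y : R) :
  `|sin (c * x) - sin (c * y)| <= `|c| * `|x - y|.
Proof.
apply: (lipschitz_of_derive R (fun x => sin (c * x)) (fun x => cos (c * x) * c)).
  by move=> z; apply: is_derive_eq; rewrite /GRing.scale/=; ring.
by move=> z; rewrite normrM ler_piMl// cos_max.
Qed.

(** If cos y = 1, the half-angle formula forces sin (y / 2) = 0, impossible for y / 2 strictly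
    between 0 and pi. *)
Lemma expi_neq1 (R : realType) (y : R) : 0 < y < pi *+ 2 -> expi R y != 1.
Proof.
move=> /andP[y0 y2]; apply/eqP => -[cy _].
have s0 : 0 < sin (y / 2).
  by apply: sin_gt0_pi; rewrite divr_gt0//= ltr_pdivrMr// mulr_natr.
have : cos (y / 2 *+ 2) = 1 by rewrite -mulr_natr divfK ?pnatr_eq0.
rewrite cos_mulr2n cos2sin2 => H.
have : sin (y / 2) ^+ 2 = 0 by move: H; rewrite mulrnBl; lra.
by move/eqP; rewrite sqrf_eq0 gt_eqF.
Qed.

(** A geometric sum whose ratio z satisfies z^M = 1 and, because 0 < m < M, z <> 1. *)
Lemma sum_expi_eq0 (R : realType) (M m : nat) : (0 < m < M)%N ->
  \sum_(p < M) expi R (m%:R * (pi *+ 2 * (p%:R / M%:R))) = 0.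
Proof.
move=> /andP[m0 mM]; have M0' : 0 < M%:R :> R by rewrite ltr0n (ltn_trans m0 mM).
have M0 : M%:R != 0 :> R by rewrite gt_eqF.
have pi2_gt0 : 0 < pi *+ 2 :> R by rewrite mulrn_wgt0// pi_gt0.
pose z := expi R (m%:R * (pi *+ 2) / M%:R).
have zp (p : nat) : expi R (m%:R * (pi *+ 2 * (p%:R / M%:R))) = z ^+ p.
  by rewrite -expiM_nat; congr expi; ring.
under eq_bigr do rewrite zp.
have z1 : z != 1.
  apply: expi_neq1; rewrite divr_gt0 ?mulr_gt0 ?ltr0n ?(ltn_trans m0 mM)//=.
  by rewrite ltr_pdivrMr// mulrC ltr_pM2l ?ltr_nat.
have zM : z ^+ M = 1.
  rewrite -expiM_nat (_ : _ * _ = m%:R * (pi *+ 2)); last by field.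
  by rewrite expiM_nat /expi cos2pi sin2pi expr1n.
have := subrX1 z M; rewrite zM subrr => /esym/eqP.
by rewrite mulf_eq0 subr_eq0 (negbTE z1)/= => /eqP.
Qed.

(** The Borel sets of the circle are generated by the traces of open sets of the plane, so only the
    preimages of these need checking. *)
Lemma measurable_of_continuous_circle d (T : measurableType d) (R : realType)
    (f : T -> circle R) :
  (forall B : set R[i]^o, open B -> measurable ((set_val \o f) @^-1` B)) ->
  @measurable_fun _ _ T (borel_circle R) setT f.
Proof.
move=> H; apply: (@measurability _ _ _ (borel_circle R) _ _ (@open (circle R))) => //.
move=> _ [_ [B oB <-] <-]; rewrite setTI; exact: H.
Qed.

Definition circ (R : realType) (x : R) : circle R :=
  exist _ (expi R x : R[i]^o) (mem_set (norm_expi R x : unit_circle (expi R x : R[i]^o))).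

Lemma continuous_expi (R : realType) : continuous (fun x : R => expi R x : R[i]^o).
Proof.
move=> x; apply/cvgrPdist_lt => e e0.
have /complex_realP[r er] : e \is Num.real by rewrite realE ltW.
have r0 : 0 < r by rewrite -ltcR -er.
have cc := @continuous_cos R x; have cs := @continuous_sin R x.
near=> y; apply: (le_lt_trans (normc_le_add _ _)); rewrite er ltcR.
rewrite (splitr r) ltrD//.
  by near: y; move/cvgrPdist_lt: cc; apply; rewrite divr_gt0.
by near: y; move/cvgrPdist_lt: cs; apply; rewrite divr_gt0.
Unshelve. all: by end_near. Qed.

Lemma sum_complexE (R : rcfType) (m : nat) (u v : nat -> R) :
  \sum_(i < m) (u i +i* v i) = (\sum_(i < m) u i) +i* (\sum_(i < m) v i).
Proof.
elim: m => [|m IH]; first by rewrite !big_ord0.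
by rewrite !big_ord_recr/= IH.
Qed.

(** Orthogonality of the characters on the M-th roots of unity; conjugation reduces a negative
    difference of frequencies to a positive one. *)
Lemma sum_expi_diff (R : realType) (M k j : nat) : (k < M)%N -> (j < M)%N ->
  \sum_(p < M) expi R ((k%:R - j%:R) * (pi *+ 2 * (p%:R / M%:R))) =
  (k == j)%:R * M%:R.
Proof.
move=> kM jM; case: (ltngtP k j) => [kj|jk|<-].
- rewrite mul0r; transitivity (\sum_(p < M)
      conjc (expi R ((j - k)%:R * (pi *+ 2 * (p%:R / M%:R))))).
    by apply: eq_bigr => p _; rewrite -expiN natrB ?(ltnW kj)//; congr expi; ring.
  rewrite -raddf_sum sum_expi_eq0; first exact: conjc0.
  by rewrite subn_gt0 kj (leq_ltn_trans (leq_subr _ _)).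
- rewrite mul0r -[RHS](@sum_expi_eq0 R M (k - j)).
    by apply: eq_bigr => p _; rewrite natrB// ltnW.
  by rewrite subn_gt0 jk (leq_ltn_trans (leq_subr _ _)).
- rewrite mul1r; under eq_bigr do rewrite subrr mul0r expi0.
  by rewrite sumr_const card_ord.
Qed.

Section fejer.
Context (R : realType) (a : nat -> R[i]).

(** The Fejer mean of the series with constant term 1, coefficient a_k at frequency -k and its
    conjugate at k; taking twice the real part makes it real-valued. The last summand has weight
    0. *)
Definition fejer N (x : R) : R := 1 + 2 * complex.Re (\sum_(i < N)
  ((1 - i.+1%:R / N%:R)%:C * a i.+1 * expi R (- (i.+1%:R * x)))).

Lemma fejerE N x : (fejer N x)%:C = 1 +
  \sum_(i < N) ((1 - i.+1%:R / N%:R)%:C * a i.+1) * expi R (- (i.+1%:R * x)) +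
  \sum_(i < N) conjc ((1 - i.+1%:R / N%:R)%:C * a i.+1) * expi R (i.+1%:R * x).
Proof.
rewrite /fejer rmorphD rmorph1 rmorphM rmorph_nat -addcJ addrA; congr (_ + _).
rewrite rmorph_sum; apply: eq_bigr => i _.
rewrite rmorphM; congr (_ * _).
by rewrite -[X in _ = expi R X]opprK [RHS]expiN.
Qed.

(** Expand the Fejer mean into exponentials. The frequencies k + i + 1 lie strictly between 0 and
    2(n + 1) and sum to 0; among the k - i - 1 only i = k - 1 survives; the constant term survives
    only for k = 0. *)
Lemma sum_fejer_expi (n k : nat) : (k <= n)%N ->
  \sum_(p < n.+1.*2) (fejer n.+1 (pi *+ 2 * (p%:R / n.+1.*2%:R)))%:C *
     expi R (k%:R * (pi *+ 2 * (p%:R / n.+1.*2%:R)))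
  = n.+1.*2%:R * (if k is 0%N then 1 else (1 - k%:R / n.+1%:R)%:C * a k).
Proof.
move=> kn; set M := n.+1.*2; set N := n.+1.
have NM : (N < M)%N by rewrite /M /N -addnn -addSnnS leq_addr.
have kN : (k < N)%N by [].
have kM : (k < M)%N := ltn_trans kN NM.
pose x (p : nat) : R := pi *+ 2 * (p%:R / M%:R).
pose b i : R[i] := (1 - i.+1%:R / N%:R)%:C * a i.+1.
transitivity (\sum_(p < M) expi R (k%:R * x p)
  + \sum_(i < N) b i * \sum_(p < M) expi R ((k%:R - i.+1%:R) * x p)
  + \sum_(i < N) conjc (b i) * \sum_(p < M) expi R ((k + i.+1)%:R * x p)).
  under [X in _ = _ + X + _]eq_bigr do rewrite mulr_sumr.
  under [X in _ = _ + _ + X]eq_bigr do rewrite mulr_sumr.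
  rewrite ![\sum_(i < N) \sum_(_ < _) _]exchange_big -!big_split/=.
  apply: eq_bigr => p _; rewrite fejerE -/(x p) [LHS]mulrDl [X in X + _ = _]mulrDl mul1r !mulr_suml.
  congr (_ + _ + _); apply: eq_bigr => i _; rewrite -mulrA -expiD; congr (_ * expi _ _).
    by ring.
  by rewrite natrD; ring.
rewrite [X in _ + X]big1 ?addr0; last first.
  move=> i _; rewrite sum_expi_eq0 ?mulr0// addnS/= /M -addnn addSn ltnS.
  by rewrite addnS ltnS leq_add// -ltnS.
under [X in _ + X]eq_bigr => i _.
  rewrite sum_expi_diff ?(leq_ltn_trans (ltn_ord i))//; over.
case: k kn kN kM => [|k] kn kN kM.
  rewrite [X in _ + X]big1 ?addr0 => [|i _]; last by rewrite mul0r mulr0.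
  under eq_bigr do rewrite mul0r expi0.
  by rewrite sumr_const card_ord mulr1.
rewrite sum_expi_eq0 ?kM// add0r (bigD1 (Ordinal (ltnW kN)))//= eqxx mul1r.
rewrite big1 ?addr0 1?mulrC// => i; rewrite -val_eqE/= eq_sym => /negbTE ik.
by rewrite eqSS ik mul0r mulr0.
Qed.

(** Integration against the discrete measure carried by the nodes p / M, M = 2(n + 1). They lie in
    [0, 1) and stand for the angles 2 pi p / M, which is the setting of [limit_quantile]. *)
Definition fejer_mean (n : nat) (f : R -> R) : R :=
  n.+1.*2%:R^-1 * \sum_(p < n.+1.*2)
    fejer n.+1 (pi *+ 2 * (p%:R / n.+1.*2%:R)) * f (p%:R / n.+1.*2%:R).

Lemma fejer_mean_expi (n k : nat) : (k <= n)%N ->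
  fejer_mean n (fun x => cos (k%:R * (pi *+ 2) * x)) +i*
  fejer_mean n (fun x => sin (k%:R * (pi *+ 2) * x)) =
  if k is 0%N then 1 else (1 - k%:R / n.+1%:R)%:C * a k.
Proof.
move=> kn; set rhs := RHS; rewrite /fejer_mean.
set M := n.+1.*2; have M0 : M%:R != 0 :> R by rewrite pnatr_eq0.
transitivity ((M%:R^-1)%:C * (M%:R * rhs)); last first.
  by rewrite mulrA fmorphV rmorph_nat mulVf ?mul1r// pnatr_eq0.
rewrite /rhs -(sum_fejer_expi _ _ kn) -/M.
rewrite (_ : \sum_(_ < _) _ = (\sum_(p < M) fejer n.+1 (pi *+ 2 * (p%:R / M%:R)) *
     cos (k%:R * (pi *+ 2) * (p%:R / M%:R))) +i* (\sum_(p < M)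
     fejer n.+1 (pi *+ 2 * (p%:R / M%:R)) * sin (k%:R * (pi *+ 2) * (p%:R / M%:R)))).
  by apply/eqP; rewrite eq_complex/= !mul0r subr0 addr0 !eqxx.
rewrite -(sum_complexE _ _ (fun p => fejer n.+1 (pi *+ 2 * (p%:R / M%:R)) *
     cos (k%:R * (pi *+ 2) * (p%:R / M%:R))) (fun p => fejer n.+1 (pi *+ 2 * (p%:R / M%:R)) *
     sin (k%:R * (pi *+ 2) * (p%:R / M%:R)))).
apply: eq_bigr => p _; rewrite /expi -mulrA.
by apply/eqP; rewrite eq_complex/= !mul0r subr0 addr0 !mulrA !eqxx.
Qed.

End fejer.

Lemma fejer_factor_cvg (R : realType) (k : nat) (c : R) :
  (1 - k%:R / n.+1%:R) * c @[n --> \oo] --> c.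
Proof.
rewrite -[X in _ --> X]mul1r; apply: cvgMr_tmp.
rewrite -[X in _ --> X]subr0; apply: cvgB; first exact: cvg_cst.
rewrite -(mulr0 k%:R); apply: cvgMl_tmp; exact: cvg_harmonic.
Qed.

Lemma pushforward_probability d d' (T : measurableType d) (T' : measurableType d')
    (R : realType) (P : probability T R) (X : T -> T') :
  measurable_fun setT X -> exists mu : probability T' R,
    forall (f : T' -> R) (M : R), measurable_fun setT f -> (forall y, `|f y| <= M) ->
      \int[mu]_y f y = \int[P]_x f (X x).
Proof.
move=> mX; pose mX_mixin := isMeasurableFun.Build _ _ _ _ X mX.
pose X' : {mfun T >-> T'} := HB.pack X mX_mixin.
exists (distribution P X') => f M mf fM; rewrite /Rintegral.
rewrite integral_distribution//; first exact/measurable_EFinP.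
exact: (bounded_integrable _ _ _ P (f \o X) M (measurableT_comp mf mX) (fun x => fM (X x))).
Qed.

(** * Bounded Borel functions on the circle *)

Lemma measurable_circle_continuous (R : realType) (f : circle R -> R) :
  continuous f -> @measurable_fun _ _ (borel_circle R) R setT f.
Proof.
move=> cf; apply: (@measurability _ _ (borel_circle R) R setT f (@RGenOpens.G R)
  (RGenOpens.measurableE R)).
move=> _ [_ [a [b ->]] <-]; rewrite setTI; apply: sub_sigma_algebra.
by move/continuousP : cf; apply; exact: interval_open.
Qed.

Lemma continuous_circle_val (R : realType) :
  continuous (set_val : circle R -> R[i]^o).
Proof. exact: initial_continuous. Qed.

(** A class stable under sums, products, powers and conjugation whose members are integrable for
    every probability, so integrability is settled once for all polynomial expressions in z and its
    conjugate. *)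
Definition bounded_borel (R : realType) (f : borel_circle R -> R[i]) :=
  [/\ measurable_fun setT (fun z => complex.Re (f z)),
      measurable_fun setT (fun z => complex.Im (f z)) &
      exists M : R, forall z, `|complex.Re (f z)| <= M /\ `|complex.Im (f z)| <= M].

Lemma norm_Im_le (R : rcfType) (z : R[i]) : `|complex.Im z|%:C <= `|z|.
Proof. by rewrite normc_def lecR -sqrtr_sqr ler_wsqrtr// lerDr sqr_ge0. Qed.

Lemma continuous_Re (R : realType) : continuous (fun z : R[i]^o => complex.Re z : R).
Proof.
move=> z; have Fz : Filter (nbhs z) by apply: nbhs_filter.
apply/(@cvgrPdist_lt _ R _ (nbhs z)) => e e0.
have H : \forall w \near z, `|z - w| < e%:C.
  by have := @nbhsx_ballx _ _ z e%:C; rewrite -ball_normE; apply; rewrite ltcR.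
apply: (@filterS _ (nbhs z) _ _ _ _ H) => w; rewrite -ltcR -raddfB.
by apply: le_lt_trans; exact: normc_ge_Re.
Qed.

Lemma continuous_Im (R : realType) : continuous (fun z : R[i]^o => complex.Im z : R).
Proof.
move=> z; have Fz : Filter (nbhs z) by apply: nbhs_filter.
apply/(@cvgrPdist_lt _ R _ (nbhs z)) => e e0.
have H : \forall w \near z, `|z - w| < e%:C.
  by have := @nbhsx_ballx _ _ z e%:C; rewrite -ball_normE; apply; rewrite ltcR.
apply: (@filterS _ (nbhs z) _ _ _ _ H) => w; rewrite -ltcR -raddfB.
by apply: le_lt_trans; exact: norm_Im_le.
Qed.

Lemma bounded_borel_val (R : realType) : bounded_borel R (fun z => set_val z).
Proof.
split.
- apply: (@measurable_circle_continuous R (fun z => complex.Re (set_val z))) => z.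
  exact: (@continuous_comp (circle R) R[i]^o R set_val
    (fun w : R[i]^o => complex.Re w) z (continuous_circle_val R z) (continuous_Re R _)).
- apply: (@measurable_circle_continuous R (fun z => complex.Im (set_val z))) => z.
  exact: (@continuous_comp (circle R) R[i]^o R set_val
    (fun w : R[i]^o => complex.Im w) z (continuous_circle_val R z) (continuous_Im R _)).
exists 1 => z; have z1 : `|set_val z| = 1 by exact: (set_valP z).
by split; rewrite -lecR -[1%:C]z1; [exact: normc_ge_Re|exact: norm_Im_le].
Qed.

Lemma bounded_borel_cst (R : realType) (c : R[i]) : bounded_borel R (fun=> c).
Proof.
split; [exact: measurable_cst|exact: measurable_cst|].
exists (`|complex.Re c| + `|complex.Im c|) => _.
by rewrite lerDl lerDr !normr_ge0.
Qed.

Lemma bounded_borelD (R : realType) f g : bounded_borel R f -> bounded_borel R g ->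
  bounded_borel R (fun z => f z + g z).
Proof.
move=> [fr fi [M fM]] [gr gi [N gN]]; split.
- by under eq_fun do rewrite raddfD/=; exact: measurable_funD.
- by under eq_fun do rewrite raddfD/=; exact: measurable_funD.
exists (M + N) => z; rewrite !raddfD/=; have [? ?] := fM z; have [? ?] := gN z.
by split; rewrite (le_trans (ler_normD _ _))// lerD.
Qed.

Lemma complex_ReM (R : rcfType) (z w : R[i]) : complex.Re (z * w) =
  complex.Re z * complex.Re w - complex.Im z * complex.Im w.
Proof. by case: z w => [? ?] [? ?]. Qed.

Lemma complex_ImM (R : rcfType) (z w : R[i]) : complex.Im (z * w) =
  complex.Re z * complex.Im w + complex.Im z * complex.Re w.
Proof. by case: z w => [? ?] [? ?]. Qed.

Lemma bounded_borelM (R : realType) f g : bounded_borel R f -> bounded_borel R g ->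
  bounded_borel R (fun z => f z * g z).
Proof.
move=> [fr fi [M fM]] [gr gi [N gN]]; split.
- by under eq_fun do rewrite complex_ReM; apply: measurable_funB; exact: measurable_funM.
- by under eq_fun do rewrite complex_ImM; apply: measurable_funD; exact: measurable_funM.
exists (M * N + M * N) => z; rewrite complex_ReM complex_ImM.
have [? ?] := fM z; have [? ?] := gN z.
split; [rewrite (le_trans (ler_normB _ _))//|rewrite (le_trans (ler_normD _ _))//];
  by rewrite lerD// normrM ler_pM.
Qed.

Lemma bounded_borel_conj (R : realType) f : bounded_borel R f ->
  bounded_borel R (fun z => conjc (f z)).
Proof.
have ReJ (z : R[i]) : complex.Re (conjc z) = complex.Re z by case: z.
have ImJ (z : R[i]) : complex.Im (conjc z) = - complex.Im z by case: z.
move=> [fr fi [M fM]]; split.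
- by under eq_fun do rewrite ReJ.
- by under eq_fun do rewrite ImJ; exact: measurableT_comp.
by exists M => z; rewrite ReJ ImJ normrN.
Qed.

Lemma bounded_borelX (R : realType) f n : bounded_borel R f ->
  bounded_borel R (fun z => f z ^+ n).
Proof.
move=> bf; elim: n => [|n IH]; first exact: bounded_borel_cst.
by under eq_fun do rewrite exprS; exact: bounded_borelM.
Qed.

Lemma herglotz (R : realType) (a : nat -> R[i]) : a 0%N = 1 ->
  (forall n x, 0 <= fejer R a n.+1 x) ->
  exists mu : probability (borel_circle R) R, forall k, fourier_coef mu k = a k.
Proof.
move=> a0 fejer_ge0.
have E_lin n c f g : fejer_mean R a n (fun x => c * f x + g x) =
    c * fejer_mean R a n f + fejer_mean R a n g.
  rewrite /fejer_mean [c * _]mulrCA -mulrDr [c * _]mulr_sumr -big_split/=; congr (_ * _).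
  by apply: eq_bigr => p _; ring.
have E_ge0 n (f : R -> R) : (forall x, 0 <= x < 1 -> 0 <= f x) ->
    0 <= fejer_mean R a n f.
  move=> f0; rewrite /fejer_mean mulr_ge0 ?invr_ge0// sumr_ge0// => p _.
  rewrite mulr_ge0// f0// divr_ge0//= ltr_pdivrMr ?ltr0n//.
  by rewrite mul1r ltr_nat ltn_ord.
have E_1 n : fejer_mean R a n (fun=> 1) = 1.
  have /(congr1 (@complex.Re R)) /= := @fejer_mean_expi R a n 0 (leq0n n).
  by under eq_fun do rewrite !mul0r cos0.
have [Q [mQ QE]] := limit_quantile R _ E_lin E_ge0 E_1.
pose X (t : R) : borel_circle R := circ R (pi *+ 2 * Q t).
have mX : @measurable_fun _ _ R (borel_circle R) setT X.
  apply: (@measurable_of_continuous_circle _ R) => B oB.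
  have -> : (set_val \o X) @^-1` B = Q @^-1` ((fun x => expi R (pi *+ 2 * x)) @^-1` B) by [].
  rewrite -[X in measurable X]setTI; apply: mQ => //; apply: open_measurable.
  have cE : continuous (fun x : R => expi R (pi *+ 2 * x) : R[i]^o).
    move=> x; apply: (@continuous_comp R R R[i]^o (fun x => pi *+ 2 * x) (@expi R : R -> R[i]^o)).
      exact: mulrl_continuous.
    exact: continuous_expi.
  by move/continuousP : cE; apply.
have [mu muE] := @pushforward_probability _ _ _ _ R (uniform_prob (@ltr01 R)) X mX.
exists mu => k; pose c : R := k%:R * (pi *+ 2).
have Xk t : set_val (X t) ^+ k = cos (c * Q t) +i* sin (c * Q t).
  by rewrite /= -expiM_nat mulrA.
have [mre mim [M bM]] := bounded_borelX R _ k (bounded_borel_val R).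
(* The moment of order k is exact as soon as n >= k. At k = 0 the factor is 1 and the hypothesis a_0
   = 1 supplies the constant term. *)
have near_eq : \forall n \near \oo,
    (1 - k%:R / n.+1%:R)%:C * a k =
    fejer_mean R a n (fun x => cos (c * x)) +i* fejer_mean R a n (fun x => sin (c * x)).
  near=> n; rewrite fejer_mean_expi; last by near: n; exact: nbhs_infty_ge.
  by case: (k) => //; rewrite mul0r subr0 a0 mulr1.
apply/eqP; rewrite eq_complex /=; apply/andP; split; apply/eqP.
- rewrite (muE _ M mre (fun z => (bM z).1)).
  under eq_Rintegral do rewrite Xk.
  apply: (QE (fun x => cos (c * x)) `|c|); last first.
  + have := @fejer_factor_cvg R k (complex.Re (a k)); apply: cvg_trans.
    apply: near_eq_cvg; near=> n.
    have := near near_eq n; move=> /(_ _)/(congr1 (@complex.Re R))/= <-//.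
    by rewrite complex_ReM/= mul0r subr0.
  + exact: cos_scale_lipschitz.
  + move=> x; apply: (@continuous_comp R R R (fun x => c * x) (@cos R)).
      exact: mulrl_continuous.
    exact: continuous_cos.
- rewrite (muE _ M mim (fun z => (bM z).2)).
  under eq_Rintegral do rewrite Xk.
  apply: (QE (fun x => sin (c * x)) `|c|); last first.
  + have := @fejer_factor_cvg R k (complex.Im (a k)); apply: cvg_trans.
    apply: near_eq_cvg; near=> n.
    have := near near_eq n; move=> /(_ _)/(congr1 (@complex.Im R))/= <-//.
    by rewrite complex_ImM/= mul0r addr0.
  + exact: sin_scale_lipschitz.
  + move=> x; apply: (@continuous_comp R R R (fun x => c * x) (@sin R)).
      exact: mulrl_continuous.
    exact: continuous_sin.
Unshelve. all: by end_near. Qed.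

(** * Contractions *)

Section contraction.
Context (R : realType) (H : completeNormedModType R[i]) (dot : {dot H for Num.conj}).
Context (T : {linear H -> H}).
Hypothesis dotN : induces_norm dot.
Hypothesis contrT : linear_contraction T.

(** The norm of [H] takes values in [R[i]]; its square is moved to [R], where ordered arithmetic is
    available. *)
Let nsq (v : H) : R := complex.Re (dot v v).

Lemma dot_real v : dot v v = (nsq v)%:C.
Proof. by rewrite /nsq RRe_real// -dotN realX// normr_real. Qed.

Lemma nsq_ge0 v : 0 <= nsq v.
Proof. by rewrite -ler0c -dot_real -dotN exprn_ge0. Qed.

Lemma dotC u v : dot u v = conjc (dot v u).
Proof. by rewrite hermC /= expr0 mul1r. Qed.

Lemma nsqD u v : nsq (u + v) = nsq u + nsq v + 2 * complex.Re (dot v u).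
Proof.
rewrite /nsq linearDl/= !linearDr/= (dotC u v) !raddfD/=.
have -> : complex.Re (conjc (dot v u)) = complex.Re (dot v u) by case: (dot v u).
ring.
Qed.

Lemma nsqZ c v : `|c| = 1 -> nsq (c *: v) = nsq v.
Proof.
move=> c1; rewrite /nsq linearZl_LR linearZr_LR/= mulrA.
by rewrite -normCK c1 expr1n mul1r.
Qed.

Lemma nsqT v : nsq (T v) <= nsq v.
Proof. by rewrite -lecR -!dot_real -!dotN lerXn2r ?nnegrE// contrT. Qed.

Let orbit_sum (w : R[i]) (x : H) N : H := \sum_(i < N) w ^+ i *: iter i T x.

Lemma orbit_sumS w x N : orbit_sum w x N.+1 = x + w *: T (orbit_sum w x N).
Proof.
rewrite /orbit_sum big_ord_recl expr0 scale1r linear_sum scaler_sumr.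
by congr (_ + _); apply: eq_bigr => i _; rewrite linearZ scalerA exprS.
Qed.

(* The norms of the partial orbit sums [v_N = x + w T v_(N-1)] increase by at most
   [|x|^2 + 2 Re (w T v_(N-1) | x)] because [w T] is a contraction; telescoping
   shows that the Fejer mean is nonnegative. *)
Lemma orbit_sum_le (x : H) (w : R[i]) (s : nat -> R) : `|w| = 1 ->
  (forall i, s i = complex.Re (w ^+ i * dot (iter i T x) x)) -> forall N,
  nsq (orbit_sum w x N) <=
    N%:R * nsq x + 2 * \sum_(i < N) (N%:R - i.+1%:R) * s i.+1.
Proof.
move=> w1 sE; elim=> [|N IH].
  by rewrite /orbit_sum !big_ord0 /nsq linear0l mul0r mulr0 addr0.
rewrite orbit_sumS nsqD nsqZ//.
have -> : complex.Re (dot (w *: T (orbit_sum w x N)) x) = \sum_(i < N) s i.+1.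
  rewrite linearZl_LR linear_sum linear_sumlz mulr_sumr raddf_sum/=.
  apply: eq_bigr => i _; rewrite sE linearZ/= linearZl_LR/= exprS mulrA.
  by [].
have -> : \sum_(i < N.+1) (N.+1%:R - i.+1%:R) * s i.+1 =
    \sum_(i < N) (N%:R - i.+1%:R) * s i.+1 + \sum_(i < N) s i.+1.
  rewrite big_ord_recr/= subrr mul0r addr0 -big_split/=.
  by apply: eq_bigr => i _; rewrite -natr1; ring.
rewrite -natr1 [X in _ <= X](_ : _ = nsq x + (N%:R * nsq x +
  2 * \sum_(i < N) (N%:R - i.+1%:R) * s i.+1) + 2 * \sum_(i < N) s i.+1); last by ring.
by rewrite lerD2r lerD2l (le_trans (nsqT _)).
Qed.

(** For w = e^(-it) the upper bound in [orbit_sum_le], divided by N |x|^2, is exactly the Fejer mean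
    at t, and it dominates a squared norm. *)
Lemma fejer_contraction_ge0 (x : H) : x != 0 -> forall n (t : R),
  0 <= fejer R (fun i => dot (iter i T x) x / dot x x) n.+1 t.
Proof.
move=> x0 n t; pose N := n.+1.
have xx : 0 < nsq x.
  rewrite lt0r nsq_ge0 andbT; apply: contra x0 => /eqP xx.
  by rewrite -normr_eq0 -sqrf_eq0 dotN dot_real xx.
pose w := expi R (- t); pose s i := complex.Re (w ^+ i * dot (iter i T x) x).
have := orbit_sum_le x w s (norm_expi _ _) (fun=> erefl) N.
move/(le_trans (nsq_ge0 _)) => H0.
suff -> : fejer R (fun i => dot (iter i T x) x / dot x x) N t =
   (N%:R * nsq x + 2 * \sum_(i < N) (N%:R - i.+1%:R) * s i.+1) / (N%:R * nsq x).
  by rewrite divr_ge0// mulr_ge0// ltW.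
have N0 : N%:R != 0 :> R by rewrite pnatr_eq0.
have nx0 : nsq x != 0 by rewrite gt_eqF.
rewrite /fejer [RHS]mulrDl divff ?mulf_neq0//; congr (_ + _).
rewrite -mulrA mulr_suml raddf_sum/=; congr (_ * _); apply: eq_bigr => i _.
rewrite -[X in expi R X]mulrN expiM_nat -/w dot_real /s.
rewrite (_ : (1 - i.+1%:R / N%:R)%:C * (dot (T (iter i T x)) x / (nsq x)%:C) * w ^+ i.+1
  = ((N%:R - i.+1%:R) / (N%:R * nsq x))%:C * (w ^+ i.+1 * dot (T (iter i T x)) x)).
  by rewrite complex_ReM/= mul0r subr0 mulrAC.
have -> : (N%:R - i.+1%:R) / (N%:R * nsq x) = (1 - i.+1%:R / N%:R) / nsq x.
  by rewrite invfM mulrA mulrBl divff.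
rewrite rmorphM fmorphV -!mulrA; congr (_ * _).
by rewrite [LHS]mulrC -mulrA.
Qed.

Lemma contraction_measure (x : H) : x != 0 ->
  exists mu : probability (borel_circle R) R,
    forall k, fourier_coef mu k = dot (iter k T x) x / dot x x.
Proof.
move=> x0; apply: herglotz; last exact: fejer_contraction_ge0.
by rewrite /= divff// -dotN sqrf_eq0 normr_eq0.
Qed.

Lemma contraction_eigenvector (x : H) (lambda : R[i]) : `|lambda| = 1 ->
  dot (T x) x = lambda * dot x x -> T x = lambda *: x.
Proof.
move=> l1 Tx; apply/eqP; rewrite -subr_eq0 -normr_eq0 -sqrf_eq0 dotN dot_real.
suff -> : nsq (T x - lambda *: x) = 0 by [].
apply/eqP; rewrite eq_le nsq_ge0 andbT.
(* The cross term equals -2 |x|^2, so the expansion leaves |T x|^2 - |x|^2, which is at most 0 for a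
   contraction. *)
rewrite nsqD -scaleNr nsqZ ?normrN// linearZl_LR/= dotC Tx rmorphM/=.
rewrite dot_real [conjc (_%:C)]conjc_real mulrA mulNr -sqr_normc l1 expr1n mulN1r.
rewrite raddfN/=; have := nsqT x; lra.
Qed.
End contraction.

(** * From extremal sequences to eigenvectors *)

Lemma fourier_coef_dirac (R : realType) (mu : probability (borel_circle R) R) z k :
  (forall A, measurable A -> mu A = \d_z A) -> fourier_coef mu k = set_val z ^+ k.
Proof.
move=> muz; have [mre mim _] := bounded_borelX R _ k (bounded_borel_val R).
have E (f : borel_circle R -> R) : measurable_fun setT f -> \int[mu]_t f t = f z.
  move=> mf; rewrite /Rintegral.
  rewrite (eq_measure_integral (dirac z)); last by move=> A mA _; exact: muz.
  by rewrite integral_dirac ?diracT ?mul1e//; exact/measurable_EFinP.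
rewrite /fourier_coef /cintegral (E _ mre) (E _ mim).
by case: (_ ^+ k).
Qed.

Lemma extremal_contraction (R : realType) (k : nat -> nat) : wiener_extremal R k ->
  forall (H : completeNormedModType R[i]) (dot : {dot H for Num.conj})
     (T : {linear H -> H}) (x : H),
     induces_norm dot -> linear_contraction T -> x != 0 ->
     cesaro_mean (fun n => `|dot (iter (k n) T x) x| ^+ 2) @ \oo
       --> (`|x| ^+ 4 : R[i]^o) ->
     unimodular_eigenvector T x.
Proof.
move=> ext H dot T x dotN contrT x0 cv; split => //.
have [mu muE] := contraction_measure R H dot T dotN contrT x x0.
have [|z muz] := ext mu.
  (* The coefficients are the orbit products divided by |x|^2; squaring moduli gives the factor
     |x|^(-4), which normalises the limit |x|^4 to 1. *)
  have -> : cesaro_mean (fun n => `|fourier_coef mu (k n)| ^+ 2) =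
      (fun N => (`|x| ^+ 4)^-1 *: cesaro_mean (fun n => `|dot (iter (k n) T x) x| ^+ 2) N).
    apply/funext => N; rewrite /cesaro_mean /GRing.scale/= mulrCA; congr (_ * _).
    rewrite mulr_sumr; apply: eq_bigr => i _; rewrite muE -dotN normrM exprMn.
    by rewrite normfV normrX normr_id -exprVn -exprM exprVn mulrC.
  rewrite -(@mulVf _ (`|x| ^+ 4)) ?expf_neq0 ?normr_eq0//.
  exact: cvgZl_tmp.
have z1 : `|set_val z| = 1 by exact: (set_valP z).
exists (set_val z) => //; apply: (contraction_eigenvector R H dot T dotN contrT) => //.
have := fourier_coef_dirac R mu z 1 muz; rewrite muE expr1 /= => <-.
by rewrite divfK// -dotN sqrf_eq0 normr_eq0.
Qed.

Set Implicit Arguments.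
Unset Strict Implicit.
Unset Printing Implicit Defensive.

(** Evaluate at the vertex t = - r / b. If b = 0 and r <> 0 the function is affine and t = - (a + 1)
    / (2 r) gives it the value -1. *)
Lemma discriminant_le (R : realFieldType) (a b r : R) : 0 <= b ->
  (forall t, 0 <= a + 2 * t * r + t ^+ 2 * b) -> r ^+ 2 <= a * b.
Proof.
move=> b0 H; move: b0; rewrite le_eqVlt => /predU1P[b0|b0].
  have [->|r0] := eqVneq r 0; first by rewrite -b0 mulr0 expr0n.
  have := H (- (a + 1) / (2 * r)).
  have -> : a + 2 * (- (a + 1) / (2 * r)) * r + (- (a + 1) / (2 * r)) ^+ 2 * b = -1.
    by rewrite -b0 mulr0 addr0; field.
  by rewrite oppr_ge0 ler10.
have b1 : b != 0 by rewrite gt_eqF.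
have := H (- r / b).
have -> : a + 2 * (- r / b) * r + (- r / b) ^+ 2 * b = (a * b - r ^+ 2) / b by field.
by rewrite pmulr_lge0 ?invr_gt0// subr_ge0.
Qed.

(** * Completion of a semi-definite inner product space *)

Section complex_limits.
Context (R : realType).
Implicit Types (u v : nat -> R[i]) (l : R[i]).

(** Splitting into coordinates avoids the topology of [R[i]^o] and reuses limits of real
    sequences. *)
Definition cvgc u l := (fun n => complex.Re (u n)) @ \oo --> complex.Re l /\
  (fun n => complex.Im (u n)) @ \oo --> complex.Im l.

Lemma cvgc_cst l : cvgc (fun=> l) l.
Proof. by split; exact: cvg_cst. Qed.

Lemma cvgcD u v l k : cvgc u l -> cvgc v k -> cvgc (fun n => u n + v n) (l + k).
Proof.
move=> [ur ui] [vr vi]; split; rewrite raddfD/=; under eq_fun do rewrite raddfD/=;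
  exact: cvgD.
Qed.

Lemma cvgcM u v l k : cvgc u l -> cvgc v k -> cvgc (fun n => u n * v n) (l * k).
Proof.
move=> [ur ui] [vr vi]; split.
  rewrite complex_ReM; under eq_fun do rewrite complex_ReM.
  by apply: cvgB; exact: cvgM.
rewrite complex_ImM; under eq_fun do rewrite complex_ImM.
by apply: cvgD; exact: cvgM.
Qed.

Lemma cvgc_conj u l : cvgc u l -> cvgc (fun n => conjc (u n)) (conjc l).
Proof.
have ReJ (z : R[i]) : complex.Re (conjc z) = complex.Re z by case: z.
have ImJ (z : R[i]) : complex.Im (conjc z) = - complex.Im z by case: z.
move=> [ur ui]; split.
  by rewrite ReJ; under eq_fun do rewrite ReJ.
by rewrite ImJ; under eq_fun do rewrite ImJ; exact: cvgN.
Qed.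

Lemma cvgc_unique u l k : cvgc u l -> cvgc u k -> l = k.
Proof.
move=> [ur ui] [vr vi]; apply/eqP; rewrite eq_complex; apply/andP; split; apply/eqP.
  exact: (cvg_unique _ ur vr).
exact: (cvg_unique _ ui vi).
Qed.

Lemma real_cauchy_cvg (u : nat -> R) :
  (forall e, 0 < e -> exists K, forall n, (K <= n)%N -> `|u K - u n| < e) ->
  exists l : R, u @ \oo --> l.
Proof.
move=> uC; suff : cvg (u @ \oo) by move/cvg_ex.
apply: cauchy_cvg; apply: cauchy_exP => e e0.
have [K HK] := uC e e0; exists (u K).
by exists K => // n /= Kn; exact: HK.
Qed.

Lemma null_cvgc u v l (b : nat -> R) : cvgc u l ->
  (forall n, `|complex.Re (v n - u n)| <= b n) ->
  (forall n, `|complex.Im (v n - u n)| <= b n) ->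
  b @ \oo --> (0 : R) -> cvgc v l.
Proof.
move=> [ur ui] vr vi b0.
have H (f g : nat -> R) (c : R) : f @ \oo --> c -> (forall n, `|g n - f n| <= b n) ->
    g @ \oo --> c.
  move=> fc gf; have -> : g = (fun n => f n + (g n - f n)).
    by apply/funext => n; rewrite addrC subrK.
  rewrite -[c]addr0; apply: cvgD => //; apply/norm_cvg0P.
  apply: (@squeeze_cvgr _ _ _ _ (fun=> 0) b) => //; last exact: cvg_cst.
  by near=> n; rewrite normr_ge0/= gf.
split.
  by apply: (H _ _ _ ur) => n; have := vr n; rewrite raddfB.
by apply: (H _ _ _ ui) => n; have := vi n; rewrite raddfB.
Unshelve. all: by end_near. Qed.

End complex_limits.

Record semidot (R : realType) (V : lmodType R[i]) := SemiDot {
  semidot_fun :> V -> V -> R[i];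
  semidotP : forall v a p q,
    semidot_fun (a *: p + q) v = a * semidot_fun p v + semidot_fun q v;
  semidotC : forall p q, semidot_fun p q = conjc (semidot_fun q p);
  semidot_ge0 : forall p, 0 <= semidot_fun p p }.

Section semidot_theory.
Context (R : realType) (V : lmodType R[i]) (s : semidot V).

Lemma semidot0l v : s 0 v = 0.
Proof.
have := semidotP s v (-1) 0 0; rewrite scaler0 addr0 mulN1r addNr.
by [].
Qed.

Lemma semidotDl p q v : s (p + q) v = s p v + s q v.
Proof. by have := semidotP s v 1 p q; rewrite scale1r mul1r. Qed.

Lemma semidotZl a p v : s (a *: p) v = a * s p v.
Proof. by have := semidotP s v a p 0; rewrite !addr0 semidot0l addr0. Qed.

Lemma semidotBl p q v : s (p - q) v = s p v - s q v.
Proof. by rewrite semidotDl -scaleN1r semidotZl mulN1r. Qed.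

Lemma semidotDr p q v : s v (p + q) = s v p + s v q.
Proof. by rewrite semidotC semidotDl rmorphD/= -!semidotC. Qed.

Lemma semidotZr a p v : s v (a *: p) = conjc a * s v p.
Proof. by rewrite semidotC semidotZl rmorphM/= -semidotC. Qed.

Lemma semidotBr p q v : s v (p - q) = s v p - s v q.
Proof. by rewrite semidotC semidotBl rmorphB/= -!semidotC. Qed.

Definition snorm p := Num.sqrt (complex.Re (s p p)).

Lemma Re_semidot_ge0 p : 0 <= complex.Re (s p p).
Proof. by have := semidot_ge0 s p; rewrite lecE => /andP[]. Qed.

Lemma semidotE p : s p p = ((snorm p) ^+ 2)%:C.
Proof.
rewrite /snorm sqr_sqrtr ?Re_semidot_ge0//.
have := semidot_ge0 s p; rewrite lecE => /andP[/eqP im0 _].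
by apply/eqP; rewrite eq_complex/= im0/= !eqxx.
Qed.

Lemma snorm_ge0 p : 0 <= snorm p.
Proof. exact: sqrtr_ge0. Qed.

Lemma snorm0 : snorm 0 = 0.
Proof. by rewrite /snorm semidot0l/= sqrtr0. Qed.

Lemma snormD_sqr p q : snorm (p + q) ^+ 2 =
  snorm p ^+ 2 + snorm q ^+ 2 + 2 * complex.Re (s p q).
Proof.
apply: (@complexI R); rewrite rmorphD rmorphD/= -!semidotE.
rewrite semidotDl !semidotDr (semidotC s q p) rmorphM rmorph_nat -addcJ.
ring.
Qed.

Lemma snormZ a p : (snorm (a *: p))%:C = `|a| * (snorm p)%:C.
Proof.
apply/eqP; rewrite -(@eqrXn2 _ 2)//; last 2 first.
- by rewrite lecR snorm_ge0.
- by rewrite mulr_ge0// lecR snorm_ge0.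
apply/eqP; rewrite -rmorphXn/= -semidotE semidotZl semidotZr mulrA -sqr_normc.
by rewrite semidotE rmorphXn exprMn.
Qed.

Lemma snormN p : snorm (- p) = snorm p.
Proof.
by apply: (@complexI R); have := snormZ (-1) p; rewrite scaleN1r normrN1 mul1r.
Qed.

Lemma snormBC p q : snorm (p - q) = snorm (q - p).
Proof. by rewrite -snormN opprB. Qed.

(** Cauchy-Schwarz: for real t the square of [snorm (p + t q)] is a nonnegative quadratic in t, so
    its discriminant is at most 0. *)
Lemma Re_semidot_le p q : `|complex.Re (s p q)| <= snorm p * snorm q.
Proof.
rewrite -(@ler_pXn2r _ 2)// ?nnegrE ?mulr_ge0 ?snorm_ge0//.
rewrite real_normK ?num_real// exprMn; apply: discriminant_le; first exact: sqr_ge0.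
move=> t; have := sqr_ge0 (snorm (p + t%:C *: q)); rewrite snormD_sqr.
have -> : snorm (t%:C *: q) ^+ 2 = t ^+ 2 * snorm q ^+ 2.
  apply: (@complexI R); rewrite rmorphXn/= snormZ exprMn sqr_normc conjc_real.
  by rewrite rmorphM !rmorphXn -expr2.
rewrite semidotZr conjc_real complex_ReM/= mul0r subr0 addrAC mulrA.
by [].
Qed.

(** Im z = Re (-i z), and multiplying p by -i preserves its seminorm. *)
Lemma Im_semidot_le p q : `|complex.Im (s p q)| <= snorm p * snorm q.
Proof.
have -> : complex.Im (s p q) = complex.Re (s ((- 'i%C) *: p) q).
  by rewrite semidotZl complex_ReM/= oppr0 mul0r sub0r mulN1r opprK.
apply: le_trans (Re_semidot_le _ _) _; rewrite ler_wpM2r ?snorm_ge0//.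
rewrite -lecR snormZ normrN normc_def/= expr0n/= add0r expr1n sqrtr1 mul1r.
by [].
Qed.

Lemma snormD p q : snorm (p + q) <= snorm p + snorm q.
Proof.
rewrite -(@ler_pXn2r _ 2)// ?nnegrE ?addr_ge0 ?snorm_ge0//.
rewrite snormD_sqr sqrrD [X in _ <= X]addrAC lerD2l -[X in _ <= X]mulr_natl ler_pM2l//.
exact: le_trans (ler_norm _) (Re_semidot_le _ _).
Qed.

Lemma snormB_triangle p q r : snorm (p - r) <= snorm (p - q) + snorm (q - r).
Proof. by have := snormD (p - q) (q - r); rewrite addrA subrK. Qed.

End semidot_theory.

Section completion.
Context (R : realType) (V : lmodType R[i]) (s : semidot V).
Implicit Types (p q : nat -> V) (f g : V -> R[i]).

Definition scauchy p := forall e : R, 0 < e -> exists K, forall m n,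
  (K <= m)%N -> (K <= n)%N -> snorm s (p m - p n) < e.

Lemma scauchy_cst v : scauchy (fun=> v).
Proof. by move=> e e0; exists 0%N => m n _ _; rewrite subrr snorm0. Qed.

Lemma scauchy_lin a p q : scauchy p -> scauchy q -> scauchy (fun n => a *: p n + q n).
Proof.
move=> pC qC e e0.
(* Dividing by |a| + 1 instead of |a| covers a = 0. *)
have na0 : 0 < Num.sqrt (complex.Re a ^+ 2 + complex.Im a ^+ 2) + 1.
  by rewrite ltr_wpDl ?sqrtr_ge0.
have [K HK] := pC (e / 2 / (Num.sqrt (complex.Re a ^+ 2 + complex.Im a ^+ 2) + 1))
  (divr_gt0 (divr_gt0 e0 (ltr0Sn R 1)) na0).
have [L HL] := qC (e / 2) (divr_gt0 e0 (ltr0Sn R 1)).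
exists (maxn K L) => m n; rewrite !geq_max => /andP[Km Lm] /andP[Kn Ln].
have -> : a *: p m + q m - (a *: p n + q n) = a *: (p m - p n) + (q m - q n).
  by rewrite scalerBr opprD addrACA.
apply: (le_lt_trans (snormD _ _ _)); rewrite (splitr e) ler_ltD ?HL//.
rewrite -lecR snormZ normc_def -rmorphM lecR.
have := HK m n Km Kn; rewrite ltr_pdivlMr// => /ltW; apply: le_trans.
by rewrite mulrC ler_wpM2l ?snorm_ge0// lerDl.
Qed.

Lemma scauchy_bound p : scauchy p ->
  exists M K, 0 < M /\ forall n, (K <= n)%N -> snorm s (p n) < M.
Proof.
move=> /(_ 1 ltr01)[K HK]; exists (snorm s (p K) + 1), K; split.
  by rewrite ltr_wpDl ?snorm_ge0.
move=> n Kn; rewrite -[p n](subrK (p K)) addrC.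
apply: le_lt_trans (snormD _ _ _) _; rewrite ler_ltD//; exact: HK.
Qed.

(** Insert the mixed term [s (p m) (q n)] and apply Cauchy-Schwarz to each of the two
    differences. *)
Lemma semidot_dist p q m n :
  snorm s (p m) * snorm s (q m - q n) + snorm s (p m - p n) * snorm s (q n) >=
    `|complex.Re (s (p m) (q m)) - complex.Re (s (p n) (q n))| /\
  snorm s (p m) * snorm s (q m - q n) + snorm s (p m - p n) * snorm s (q n) >=
    `|complex.Im (s (p m) (q m)) - complex.Im (s (p n) (q n))|.
Proof.
rewrite -!raddfB.
have -> : s (p m) (q m) - s (p n) (q n) = s (p m) (q m - q n) + s (p m - p n) (q n).
  by rewrite semidotBr semidotBl addrA subrK.
rewrite !raddfD/=; split; apply: le_trans (ler_normD _ _) _; apply: lerD;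
  by [exact: Re_semidot_le|exact: Im_semidot_le].
Qed.

Lemma scauchy_pair p q : scauchy p -> scauchy q ->
  exists l, cvgc (fun n => s (p n) (q n)) l.
Proof.
move=> pC qC; have [M [K [M0 HM]]] := scauchy_bound pC.
have [N [L [N0 HN]]] := scauchy_bound qC.
have H (e : R) : 0 < e -> exists J, forall n, (J <= n)%N ->
    snorm s (p J) * snorm s (q J - q n) + snorm s (p J - p n) * snorm s (q n) < e.
  move=> e0; have [K' HK'] := pC (e / 2 / N) (divr_gt0 (divr_gt0 e0 (ltr0Sn R 1)) N0).
  have [L' HL'] := qC (e / 2 / M) (divr_gt0 (divr_gt0 e0 (ltr0Sn R 1)) M0).
  exists (maxn (maxn K K') (maxn L L')) => n; set J := maxn _ _; move=> Jn.
  have := leqnn J; rewrite {1}/J !geq_max => /andP[/andP[KJ K'J] /andP[LJ L'J]].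
  rewrite (splitr e) ltrD//.
    apply: (@le_lt_trans _ _ (M * snorm s (q J - q n))).
      by rewrite ler_wpM2r ?snorm_ge0// ltW// HM.
    by rewrite -ltr_pdivlMl// mulrC HL'// (leq_trans L'J).
  apply: (@le_lt_trans _ _ (snorm s (p J - p n) * N)).
    by rewrite ler_wpM2l ?snorm_ge0// ltW// HN// (leq_trans LJ).
  by rewrite -ltr_pdivlMr// HK'// (leq_trans K'J).
have [a ha] : exists l : R, (fun n => complex.Re (s (p n) (q n))) @ \oo --> l.
  apply: real_cauchy_cvg => e /H[J HJ]; exists J => n /HJ.
  by apply: le_lt_trans; have [] := semidot_dist p q J n.
have [b hb] : exists l : R, (fun n => complex.Im (s (p n) (q n))) @ \oo --> l.
  apply: real_cauchy_cvg => e /H[J HJ]; exists J => n /HJ.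
  by apply: le_lt_trans; have [] := semidot_dist p q J n.
by exists (a +i* b).
Qed.

Definition represents p f := scauchy p /\ forall v, cvgc (fun n => s (p n) v) (f v).

Lemma represents_exists p : scauchy p -> exists f, represents p f.
Proof.
move=> pC; have H v := scauchy_pair pC (scauchy_cst v).
by exists (fun v => projT1 (cid (H v))); split => // v; case: cid.
Qed.

Lemma represents_unique p f g : represents p f -> represents p g -> f = g.
Proof. by move=> [_ pf] [_ pg]; apply/funext => v; exact: cvgc_unique (pf v) (pg v). Qed.

Lemma represents_lin a p q f g : represents p f -> represents q g ->
  represents (fun n => a *: p n + q n) (fun v => a * f v + g v).
Proof.
move=> [pC pf] [qC qg]; split; first exact: scauchy_lin.
move=> v; under eq_fun do rewrite semidotP.
by apply: cvgcD => //; apply: cvgcM => //; exact: cvgc_cst.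
Qed.

Lemma represents_cst v : represents (fun=> v) (s v).
Proof. by split; [exact: scauchy_cst|move=> w; exact: cvgc_cst]. Qed.

Definition snull p := (fun n => snorm s (p n)) @ \oo --> (0 : R).

(** A Cauchy sequence that tends weakly to 0 tends to 0 in seminorm: |p_n|^2 = (p_n | p_n - p_K) +
    (p_n | p_K), where the first term is small by boundedness and the Cauchy property, the second by
    weak convergence against the fixed p_K. Hence a functional determines its Cauchy sequence up to
    a null sequence. *)
Lemma represents0 p : represents p (fun=> 0) -> snull p.
Proof.
move=> [pC pf]; have [M [L [M0 HM]]] := scauchy_bound pC.
apply/cvgrPdist_lt => e e0; have [K HK] := pC (e ^+ 2 / 2 / M)
  (divr_gt0 (divr_gt0 (exprn_gt0 2 e0) (ltr0Sn R 1)) M0).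
have [/cvgrPdist_lt/(_ (e ^+ 2 / 2)) pK _] := pf (p K).
near=> n; rewrite sub0r normrN ger0_norm ?snorm_ge0//.
rewrite -(@ltr_pXn2r _ 2)// ?nnegrE ?snorm_ge0 ?(ltW e0)//.
have Kn : (K <= n)%N by near: n; exact: nbhs_infty_ge.
have Ln : (L <= n)%N by near: n; exact: nbhs_infty_ge.
have -> : snorm s (p n) ^+ 2 = complex.Re (s (p n) (p n - p K)) + complex.Re (s (p n) (p K)).
  by rewrite -raddfD/= -semidotDr subrK semidotE.
rewrite (splitr (e ^+ 2)) ltrD//.
  apply: (le_lt_trans (ler_norm _)); apply: (le_lt_trans (Re_semidot_le _ _ _)).
  apply: (@le_lt_trans _ _ (M * snorm s (p n - p K))).
    by rewrite ler_wpM2r ?snorm_ge0// ltW// HM.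
  by rewrite -ltr_pdivlMl// mulrC HK.
apply: (le_lt_trans (ler_norm _)); rewrite -normrN -[- _]add0r.
by near: n; apply: pK; rewrite divr_gt0 ?exprn_gt0.
Unshelve. all: by end_near. Qed.

Lemma represents_diff p q f : represents p f -> represents q f ->
  snull (fun n => p n - q n).
Proof.
move=> pf qf; apply: represents0.
have := represents_lin (-1) qf pf.
have -> : (fun n => -1 *: q n + p n) = (fun n => p n - q n).
  by apply/funext => n; rewrite scaleN1r addrC.
by have -> : (fun v => -1 * f v + f v) = (fun=> 0); first by
  apply/funext => v; rewrite mulN1r addNr.
Qed.

Lemma snull_represents p q f : represents p f -> scauchy q ->
  snull (fun n => p n - q n) -> represents q f.
Proof.
move=> [pC pf] qC pq; split => // v.
apply: (null_cvgc (b := fun n => snorm s (q n - p n) * snorm s v) (pf v)).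
- by move=> n; rewrite -semidotBl Re_semidot_le.
- by move=> n; rewrite -semidotBl Im_semidot_le.
rewrite -[X in _ --> X](mul0r (snorm s v)); apply: cvgMr_tmp.
by under eq_fun do rewrite snormBC.
Qed.

(** Makes the inner product of two functionals independent of their representatives: the difference
    is (p_n | q'_n - q_n) + (p'_n - p_n | q'_n), a bounded sequence against a null one in each
    term. *)
Lemma cvgc_semidot_unique p p' q q' f g l :
  represents p f -> represents p' f -> represents q g -> represents q' g ->
  cvgc (fun n => s (p n) (q n)) l -> cvgc (fun n => s (p' n) (q' n)) l.
Proof.
move=> pf pf' qg qg' pql.
have [M [K [M0 HM]]] := scauchy_bound pf.1.
have [N [L [N0 HN]]] := scauchy_bound qg'.1.
have [l' pql'] := scauchy_pair pf'.1 qg'.1.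
suff E : l = l' by rewrite E.
apply/eqP; rewrite eq_sym -subr_eq0; apply/eqP.
have dl : cvgc (fun n => s (p' n) (q' n) - s (p n) (q n)) (l' - l).
  have := cvgcD pql' (cvgcM (cvgc_cst (-1)) pql); rewrite mulN1r.
  by under eq_fun do rewrite mulN1r.
have bnd : (fun n => M * snorm s (q' n - q n) + snorm s (p' n - p n) * N) @ \oo --> (0 : R).
  rewrite -[X in _ --> X](addr0 0) -[X in _ --> X + _](mulr0 M) -[X in _ --> _ + X](mul0r N).
  by apply: cvgD; [apply: cvgMl_tmp; exact: represents_diff qg' qg|
    apply: cvgMr_tmp; exact: represents_diff pf' pf].
have split_eq n : s (p' n) (q' n) - s (p n) (q n) =
    s (p n) (q' n - q n) + s (p' n - p n) (q' n).
  by rewrite semidotBr semidotBl [RHS]addrC addrA subrK.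
(* [h] is the real or the imaginary part; only additivity and Cauchy-Schwarz matter. *)
have b0 (h : R[i] -> R) (hD : forall a b, h (a + b) = h a + h b)
   (hs : forall v w, `|h (s v w)| <= snorm s v * snorm s w) c :
   (fun n => h (s (p' n) (q' n) - s (p n) (q n))) @ \oo --> c -> c = 0.
  move=> hc; apply: (cvg_unique _ hc) => //.
  apply/norm_cvg0P; apply: (squeeze_cvgr _ (@cvg_cst _ 0 _ _ _) bnd); near=> n.
  rewrite normr_ge0/= split_eq hD (le_trans (ler_normD _ _))// lerD//.
    rewrite (le_trans (hs _ _))// ler_wpM2r ?snorm_ge0// ltW// HM//.
    by near: n; exact: nbhs_infty_ge.
  rewrite (le_trans (hs _ _))// ler_wpM2l ?snorm_ge0// ltW// HN//.
  by near: n; exact: nbhs_infty_ge.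
have [/(b0 _ (@raddfD _ _ (@complex.Re R)) (Re_semidot_le s)) r0
      /(b0 _ (@raddfD _ _ (@complex.Im R)) (Im_semidot_le s)) i0] := dl.
by apply/eqP; rewrite eq_complex r0 i0/= !eqxx.
Unshelve. all: by end_near. Qed.

End completion.

(* A Cauchy sequence [p] stands for the functional [v |-> lim s (p n) v], which
   identifies equivalent sequences without any quotient. *)
Definition representable (R : realType) (V : lmodType R[i]) (s : semidot V) :
  {pred V -> R[i]} := fun f => `[< exists p, represents s p f >].

Record completion (R : realType) (V : lmodType R[i]) (s : semidot V) := Completion {
  completion_fun :> V -> R[i];
  completionP : completion_fun \in representable s }.

(** * The completion as a Hilbert space *)

Section completion_lmodule.
Context (R : realType) (V : lmodType R[i]) (s : semidot V).

HB.instance Definition _ := [isSub for @completion_fun R V s].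
HB.instance Definition _ := [Choice of completion s by <:].

Lemma representable_submod : submod_closed (representable s).
Proof.
split.
  apply/asboolP; exists (fun=> 0); have := represents_cst s 0.
  by have -> : s 0 = 0 :> (V -> R[i]) by apply/funext => v; rewrite semidot0l.
move=> a f g /asboolP[p pf] /asboolP[q qg]; apply/asboolP.
by exists (fun n => a *: p n + q n); exact: represents_lin.
Qed.

HB.instance Definition _ := GRing.isSubmodClosed.Build R[i] (V -> R[i]) (representable s)
  representable_submod.
HB.instance Definition _ := [SubChoice_isSubLmodule of completion s by <:].

Lemma completion_ext (f g : completion s) : (f : V -> R[i]) = g -> f = g.
Proof. exact: val_inj. Qed.

Definition repseq (f : completion s) : nat -> V :=
  projT1 (cid (asboolP _ (completionP f))).

Lemma repseqP (f : completion s) : represents s (repseq f) f.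
Proof. by rewrite /repseq; case: cid. Qed.

Definition of_cauchy (p : nat -> V) (pC : scauchy s p) : completion s :=
  let H := cid (represents_exists pC) in
  Completion (asboolT (ex_intro _ p (projT2 H))).

Lemma of_cauchyP p (pC : scauchy s p) : represents s p (of_cauchy pC).
Proof. by rewrite /of_cauchy /=; case: cid. Qed.

Definition embed (v : V) : completion s :=
  @Completion R V s (s v) (asboolT
    (ex_intro (fun p => represents s p (s v)) _ (represents_cst s v))).

Lemma embedP v : represents s (fun=> v) (embed v).
Proof. exact: represents_cst. Qed.

Lemma embed_lin a v w : embed (a *: v + w) = a *: embed v + embed w.
Proof. by apply: completion_ext; apply/funext => u; rewrite /= semidotP. Qed.

Definition cdot (f g : completion s) : R[i] :=
  projT1 (cid (scauchy_pair (repseqP f).1 (repseqP g).1)).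

Lemma cdotP p q (f g : completion s) : represents s p f -> represents s q g ->
  cvgc (fun n => s (p n) (q n)) (cdot f g).
Proof.
move=> pf qg; apply: (cvgc_semidot_unique (repseqP f) pf (repseqP g) qg).
by rewrite /cdot; case: cid.
Qed.

Lemma represents_linc a p q (f g : completion s) : represents s p f ->
  represents s q g -> represents s (fun n => a *: p n + q n) (a *: f + g : completion s).
Proof. exact: represents_lin. Qed.

Lemma represents_subc p v (f : completion s) : represents s p f ->
  represents s (fun n => p n - v) (f - embed v : completion s).
Proof.
move=> pf; have := represents_linc (-1) (embedP v) pf.
rewrite (scaleN1r (embed v)) [- embed v + _]addrC; congr (represents s _ _).
by apply/funext => n; rewrite scaleN1r addrC.
Qed.

Lemma cdot_lin h a f g : cdot (a *: f + g) h = a * cdot f h + cdot g h.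
Proof.
have := cdotP (represents_linc a (repseqP f) (repseqP g)) (repseqP h).
move=> /cvgc_unique; apply; under eq_fun do rewrite semidotP.
by apply: cvgcD; [apply: cvgcM; first exact: cvgc_cst|]; exact: (cdotP (repseqP _) (repseqP _)).
Qed.

Lemma cdotC f g : cdot f g = conjc (cdot g f).
Proof.
apply: cvgc_unique (cdotP (repseqP f) (repseqP g)) _.
by under eq_fun do rewrite semidotC; apply: cvgc_conj; exact: (cdotP (repseqP _) (repseqP _)).
Qed.

Lemma cdot_ge0 f : 0 <= cdot f f.
Proof.
have [cr ci] := cdotP (repseqP f) (repseqP f).
rewrite lecE; apply/andP; split.
  apply/eqP; apply: (cvg_unique _ ci) => //.
  have -> : (fun n => complex.Im (s (repseq f n) (repseq f n))) = (fun=> 0).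
    by apply/funext => n; rewrite semidotE.
  exact: cvg_cst.
by apply: (cvgr_to_ge cr); near=> n; exact: Re_semidot_ge0.
Unshelve. all: by end_near. Qed.

(** Packing the limit form as a [semidot] makes Cauchy-Schwarz and the triangle inequality available
    again on the completion; definiteness is separate. *)
Definition csemidot : semidot (completion s) := SemiDot cdot_lin cdotC cdot_ge0.

Lemma cdot_embed v w : cdot (embed v) (embed w) = s v w.
Proof. exact: cvgc_unique (cdotP (embedP v) (embedP w)) (cvgc_cst _). Qed.

Lemma snorm_embed v : snorm csemidot (embed v) = snorm s v.
Proof. by rewrite /snorm /= cdot_embed. Qed.

Lemma completion_snorm_cvg p (f : completion s) : represents s p f ->
  (fun n => snorm s (p n)) @ \oo --> snorm csemidot f.
Proof.
move=> pf; have [cr _] := cdotP pf pf.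
by apply: continuous_cvg; [exact: sqrt_continuous|exact: cr].
Qed.

(** The representing sequence is then null in seminorm, so by Cauchy-Schwarz the functional vanishes
    at every v. *)
Lemma completion_snorm_eq0 (f : completion s) : snorm csemidot f = 0 -> f = 0.
Proof.
move=> f0; apply: completion_ext; apply/funext => v.
have := completion_snorm_cvg (repseqP f); rewrite f0 => pn.
apply: cvgc_unique ((repseqP f).2 v) _.
apply: (null_cvgc (u := fun=> 0) (b := fun n => snorm s (repseq f n) * snorm s v)).
- exact: cvgc_cst.
- by move=> n; rewrite subr0 Re_semidot_le.
- by move=> n; rewrite subr0 Im_semidot_le.
by rewrite -[X in _ --> X](mul0r (snorm s v)); apply: cvgMr_tmp.
Qed.

Lemma embed_dense (f : completion s) (e : R) : 0 < e ->
  exists v, snorm csemidot (f - embed v) < e.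
Proof.
move=> e0; have e2 : 0 < e / 2 by rewrite divr_gt0.
have [K HK] := (repseqP f).1 _ e2; exists (repseq f K).
have Hr := represents_subc (repseq f K) (repseqP f).
apply: (@le_lt_trans _ _ (e / 2)); last by rewrite ltr_pdivrMr// ltr_pMr// ltr1n.
apply: (cvgr_to_le (completion_snorm_cvg Hr)).
exists K => // n /= Kn; apply: ltW; exact: HK.
Qed.

(* A Cauchy sequence of the completion is shadowed by a Cauchy sequence of [V],
   whose class is the limit. *)
Lemma completion_seq_complete (x : nat -> completion s) : scauchy csemidot x ->
  exists f, forall e, 0 < e -> exists K, forall n, (K <= n)%N ->
    snorm csemidot (f - x n) < e.
Proof.
move=> xC.
have h0 n : 0 < n.+1%:R^-1 :> R by rewrite invr_gt0.
have H n := embed_dense (x n) (h0 n).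
pose v n := projT1 (cid (H n)).
have vP n : snorm csemidot (x n - embed (v n)) < n.+1%:R^-1 by rewrite /v; case: cid.
have hsmall (e : R) : 0 < e -> exists K, forall n, (K <= n)%N -> n.+1%:R^-1 < e :> R.
  move=> e0; have /cvgrPdist_lt/(_ _ e0)[K _ HK] := @cvg_harmonic R.
  by exists K => n /HK; rewrite sub0r normrN ger0_norm ?invr_ge0.
have vB m n : snorm s (v m - v n) = snorm csemidot (embed (v m) - embed (v n)).
  rewrite -snorm_embed; congr snorm; have := embed_lin (-1) (v n) (v m).
  by rewrite !scaleN1r addrC [RHS]addrC.
have vC : scauchy s v.
  move=> e e0; have e3 : 0 < e / 3 by rewrite divr_gt0.
  have [K HK] := xC _ e3; have [L HL] := hsmall _ e3.
  exists (maxn K L) => m n; rewrite !geq_max => /andP[Km Lm] /andP[Kn Ln].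
  rewrite vB; apply: (le_lt_trans (snormB_triangle _ _ (x m) _)).
  have -> : e = e / 3 + (e / 3 + e / 3) by field.
  apply: ltrD; first by rewrite snormBC (lt_trans (vP _))// HL.
  apply: (le_lt_trans (snormB_triangle _ _ (x n) _)).
  by apply: ltrD; [exact: HK|rewrite (lt_trans (vP _))// HL].
exists (of_cauchy vC) => e e0; have e3 : 0 < e / 3 by rewrite divr_gt0.
have [K HK] := vC _ e3; have [L HL] := hsmall _ e3.
exists (maxn K L) => n; rewrite geq_max => /andP[Kn Ln].
apply: (le_lt_trans (snormB_triangle _ _ (embed (v n)) _)).
have -> : e = (e / 3 + e / 3) + e / 3 by field.
apply: ltrD; last by rewrite snormBC (lt_trans (vP _))// HL.
apply: (@le_lt_trans _ _ (e / 3)); last by rewrite ltrDl.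
have Hr := represents_subc (v n) (of_cauchyP vC).
apply: (cvgr_to_le (completion_snorm_cvg Hr)).
exists K => // m /= Km; apply: ltW; exact: HK.
Qed.

Definition completion_norm (f : completion s) : R[i] := (snorm csemidot f)%:C.

Lemma completion_normD f g :
  completion_norm (f + g) <= completion_norm f + completion_norm g.
Proof. by rewrite /completion_norm -rmorphD lecR snormD. Qed.

Lemma completion_normZ a f : completion_norm (a *: f) = `|a| * completion_norm f.
Proof. exact: snormZ. Qed.

Lemma completion_norm_eq0 f : completion_norm f = 0 -> f = 0.
Proof. by move=> /(@complexI R)/completion_snorm_eq0. Qed.

HB.instance Definition _ := Lmodule_isNormed.Build R[i] (completion s)
  completion_normD completion_normZ completion_norm_eq0.

Lemma completion_normE (f : completion s) : `|f| = (snorm csemidot f)%:C.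
Proof. by []. Qed.

Lemma completion_norm_le (f g : completion s) :
  snorm csemidot f <= snorm csemidot g -> `|f| <= `|g|.
Proof. by rewrite -lecR. Qed.

(** Reduces Cauchy filters to sequences: pick centres of balls of radius 1 / (n + 1) that belong to
    [F]. Any two of these balls meet, so the centres form a Cauchy sequence, and every ball around
    its limit contains one of them. *)
Lemma completion_complete (F : set_system (completion s)) :
  ProperFilter F -> cauchy F -> cvg F.
Proof.
move=> FF /cauchyP Fc.
have H n : exists x, F (ball x (n.+1%:R^-1)%:C) by apply: Fc; rewrite ltcR.
pose x n := projT1 (cid (H n)).
have xP n : F (ball (x n) (n.+1%:R^-1)%:C) by rewrite /x; case: cid.
have ballE (f g : completion s) (e : R) : ball f e%:C g -> snorm csemidot (f - g) < e.
  by rewrite -ball_normE /= completion_normE ltcR.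
have hsmall (e : R) : 0 < e -> exists K, forall n, (K <= n)%N -> n.+1%:R^-1 < e :> R.
  move=> e0; have /cvgrPdist_lt/(_ _ e0)[K _ HK] := @cvg_harmonic R.
  by exists K => n /HK; rewrite sub0r normrN ger0_norm ?invr_ge0.
have xC : scauchy csemidot x.
  move=> e e0; have e2 : 0 < e / 2 by rewrite divr_gt0.
  have [K HK] := hsmall _ e2; exists K => m n Km Kn.
  have [y [/ballE ym /ballE yn]] := filter_ex (filterI (xP m) (xP n)).
  apply: (le_lt_trans (snormB_triangle _ _ y _)); rewrite (splitr e) ltrD//.
    by rewrite (lt_trans ym)// HK.
  by rewrite snormBC (lt_trans yn)// HK.
have [f fP] := completion_seq_complete xC.
apply/cvg_ex; exists f; apply/cvg_ballP => e e0.
have /complex_realP[r er] : e \is Num.real by rewrite realE ltW.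
move: e0; rewrite er ltcR => r0; have r2 : 0 < r / 2 by rewrite divr_gt0.
have [K HK] := fP _ r2; have [L HL] := hsmall _ r2.
pose n := maxn K L; apply: filterS (xP n) => y /ballE yn.
rewrite -ball_normE /= completion_normE ltcR.
apply: (le_lt_trans (snormB_triangle _ _ (x n) _)); rewrite (splitr r) ltrD//.
  by rewrite HK// leq_maxl.
by rewrite (lt_trans yn)// HL// leq_maxr.
Qed.

HB.instance Definition _ := Uniform_isComplete.Build (completion s) completion_complete.

Lemma cdot_zmodl h : zmod_morphism (cdot^~ h).
Proof. by move=> f g; exact: (semidotBl csemidot). Qed.

Lemma cdot_zmodr f : zmod_morphism (cdot f).
Proof. by move=> g h; exact: (semidotBr csemidot). Qed.

Lemma cdot_scalel h : scalable_for *%R (cdot^~ h).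
Proof. by move=> a f; exact: (semidotZl csemidot). Qed.

Lemma cdot_scaler f : scalable_for (Num.conj \; *%R) (cdot f).
Proof. by move=> a g; exact: (semidotZr csemidot). Qed.

HB.instance Definition _ := isBilinear.Build R[i] (completion s) (completion s) R[i]
  *%R (Num.conj \; *%R) cdot cdot_zmodl cdot_zmodr cdot_scalel cdot_scaler.

Lemma cdot_hermitian f g : cdot f g = (-1) ^+ false * Num.conj (cdot g f).
Proof. by rewrite expr0 mul1r; exact: cdotC. Qed.

HB.instance Definition _ := isHermitianSesquilinear.Build R[i] (completion s) false
  Num.conj cdot cdot_hermitian.

Lemma cdot_gt0 f : f != 0 -> 0 < cdot f f.
Proof.
move=> f0; rewrite lt0r cdot_ge0 andbT; apply: contra f0 => /eqP f0.
by apply/eqP/completion_snorm_eq0; rewrite /snorm /= f0 sqrtr0.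
Qed.

HB.instance Definition _ := isDotProduct.Build R[i] (completion s) cdot cdot_gt0.

Definition completion_dot : {dot completion s for Num.conj} := cdot.

Lemma completion_dotE f g : completion_dot f g = cdot f g.
Proof. by []. Qed.

Lemma completion_induces_norm : induces_norm completion_dot.
Proof. by move=> f; rewrite completion_normE -rmorphXn /= -(semidotE csemidot). Qed.

(** * Extension of an isometry to the completion *)

Section isometry.
Variable A : V -> V.
Hypothesis A_lin : forall a p q, A (a *: p + q) = a *: A p + A q.
Hypothesis A_iso : forall p, snorm s (A p) = snorm s p.

Lemma isometryB p q : A p - A q = A (p - q).
Proof. by rewrite addrC -scaleN1r -A_lin scaleN1r addrC. Qed.

Lemma scauchy_isometry p : scauchy s p -> scauchy s (A \o p).
Proof.
move=> pC e /pC[K HK]; exists K => m n Km Kn /=.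
by rewrite isometryB A_iso HK.
Qed.

Definition extension (f : completion s) : completion s :=
  of_cauchy (scauchy_isometry (repseqP f).1).

(** Frees [extension] from the chosen representative: two representatives differ by a null sequence,
    and the isometry maps it to a null sequence. *)
Lemma extensionP p (f : completion s) : represents s p f ->
  represents s (A \o p) (extension f).
Proof.
move=> pf; apply: (snull_represents (of_cauchyP _)).
  exact: scauchy_isometry pf.1.
rewrite /snull; under eq_fun do rewrite /= isometryB A_iso.
exact: represents_diff (repseqP f) pf.
Qed.

Lemma extension_lin a f g : extension (a *: f + g) = a *: extension f + extension g.
Proof.
apply: completion_ext.
apply: (represents_unique (extensionP (represents_linc a (repseqP f) (repseqP g)))).
have := represents_linc a (extensionP (repseqP f)) (extensionP (repseqP g)).
by congr (represents s _ _); apply/funext => n /=; rewrite A_lin.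
Qed.

Lemma extension_embed v : extension (embed v) = embed (A v).
Proof.
apply: completion_ext; exact: represents_unique (extensionP (embedP v)) (embedP _).
Qed.

Lemma extension_snorm f : snorm csemidot (extension f) = snorm csemidot f.
Proof.
have := completion_snorm_cvg (extensionP (repseqP f)).
have -> : (fun n => snorm s ((A \o repseq f) n)) = (fun n => snorm s (repseq f n)).
  by apply/funext => n; rewrite /= A_iso.
move=> H; have H' := completion_snorm_cvg (repseqP f).
exact: (@cvg_unique R (@Rhausdorff R) _ _ _ _ H H').
Qed.

HB.instance Definition _ := GRing.isLinear.Build R[i] (completion s) (completion s) *:%R
  extension extension_lin.

Definition extension_linear : {linear completion s -> completion s} := extension.

Lemma extension_contraction : linear_contraction extension_linear.
Proof. by move=> f; apply: completion_norm_le; rewrite extension_snorm. Qed.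

End isometry.

End completion_lmodule.

(** * Polynomials in the square-integrable functions of a measure *)

Lemma bounded_borel_horner (R : realType) (p : {poly R[i]}) :
  bounded_borel R (fun z => p.[set_val z]).
Proof.
elim/poly_ind: p => [|p c IH].
  by under eq_fun do rewrite horner0; exact: bounded_borel_cst.
under eq_fun do rewrite hornerMXaddC.
apply: bounded_borelD; last exact: bounded_borel_cst.
by apply: bounded_borelM => //; exact: bounded_borel_val.
Qed.

Section cintegral.
Context (R : realType) (mu : probability (borel_circle R) R).
Implicit Types f g : borel_circle R -> R[i].

Lemma bounded_borel_integrable f : bounded_borel R f ->
  mu.-integrable setT (EFin \o (fun z => complex.Re (f z))) /\
  mu.-integrable setT (EFin \o (fun z => complex.Im (f z))).
Proof.
move=> [mr mi [M fM]].
by split; apply: (@bounded_integrable _ _ _ mu _ M) => // z; case: (fM z).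
Qed.

Lemma cintegralD f g : bounded_borel R f -> bounded_borel R g ->
  cintegral mu (fun z => f z + g z) = cintegral mu f + cintegral mu g.
Proof.
move=> /bounded_borel_integrable[fr fi] /bounded_borel_integrable[gr gi].
apply/eqP; rewrite eq_complex /=; apply/andP; split; apply/eqP.
  by rewrite -RintegralD//; apply: eq_Rintegral => z _; rewrite raddfD.
by rewrite -RintegralD//; apply: eq_Rintegral => z _; rewrite raddfD.
Qed.

Lemma cintegralZ a f : bounded_borel R f ->
  cintegral mu (fun z => a * f z) = a * cintegral mu f.
Proof.
move=> /bounded_borel_integrable[fr fi].
apply/eqP; rewrite eq_complex /= complex_ReM complex_ImM /=.
have Z (c : R) (h : borel_circle R -> R) : mu.-integrable setT (EFin \o h) ->
    mu.-integrable setT (EFin \o (fun z => c * h z)).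
  by move=> ih; exact: (integrableZl measurableT c ih).
rewrite -!RintegralZl// -RintegralB//; [|exact: Z..].
rewrite -RintegralD//; [|exact: Z..].
by apply/andP; split; apply/eqP; apply: eq_Rintegral => z _;
  rewrite ?complex_ReM ?complex_ImM.
Qed.

Lemma cintegral_conj f : bounded_borel R f ->
  cintegral mu (fun z => conjc (f z)) = conjc (cintegral mu f).
Proof.
move=> /bounded_borel_integrable[fr fi].
apply/eqP; rewrite eq_complex /=; apply/andP; split; apply/eqP.
  by apply: eq_Rintegral => z _; case: (f z).
rewrite -mulN1r -RintegralZl//; apply: eq_Rintegral => z _.
by rewrite mulN1r; case: (f z).
Qed.

Lemma cintegral_ge0 f : (forall z, 0 <= f z) -> 0 <= cintegral mu f.
Proof.
move=> f0; rewrite lecE /=; apply/andP; split.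
  apply/eqP; rewrite -[RHS](Rintegral_cst_probability _ _ _ mu 0).
  by apply: eq_Rintegral => z _; have := f0 z; rewrite lecE => /andP[/eqP ->].
by apply: Rintegral_ge0 => z _; have := f0 z; rewrite lecE => /andP[].
Qed.

Definition poly_form (p q : {poly R[i]}) : R[i] :=
  cintegral mu (fun z => p.[set_val z] * conjc q.[set_val z]).

Lemma bounded_borel_poly_form p q :
  bounded_borel R (fun z => p.[set_val z] * conjc q.[set_val z]).
Proof.
apply: bounded_borelM; first exact: bounded_borel_horner.
apply: bounded_borel_conj; exact: bounded_borel_horner.
Qed.

Lemma poly_form_lin q a p p' :
  poly_form (a *: p + p') q = a * poly_form p q + poly_form p' q.
Proof.
rewrite /poly_form -cintegralZ; last exact: bounded_borel_poly_form.
rewrite -cintegralD; last 2 first.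
- by apply: bounded_borelM; [exact: bounded_borel_cst|exact: bounded_borel_poly_form].
- exact: bounded_borel_poly_form.
by congr cintegral; apply/funext => z; rewrite hornerD hornerZ; ring.
Qed.

Lemma poly_formC p q : poly_form p q = conjc (poly_form q p).
Proof.
rewrite /poly_form -cintegral_conj; last exact: bounded_borel_poly_form.
by congr cintegral; apply/funext => z; rewrite rmorphM/= conjcK mulrC.
Qed.

Lemma poly_form_ge0 p : 0 <= poly_form p p.
Proof. by apply: cintegral_ge0 => z; exact: mulcJ_ge0. Qed.

Definition poly_semidot : semidot {poly R[i]} :=
  SemiDot poly_form_lin poly_formC poly_form_ge0.

Lemma mulX_lin a (p q : {poly R[i]}) : 'X * (a *: p + q) = a *: ('X * p) + 'X * q.
Proof. by rewrite mulrDr scalerAr. Qed.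

(** The integrand |z p(z)|^2 equals |p(z)|^2 pointwise because |z| = 1 on the circle. *)
Lemma mulX_iso p : snorm poly_semidot ('X * p) = snorm poly_semidot p.
Proof.
rewrite /snorm /= /poly_form; congr (Num.sqrt (complex.Re (cintegral mu _))).
apply/funext => z; rewrite hornerM hornerX rmorphM/= mulrACA -sqr_normc.
have -> : `|set_val z| = 1 by exact: (set_valP z).
by rewrite expr1n mul1r.
Qed.

Lemma poly_formX k : poly_form 'X^k 1 = fourier_coef mu k.
Proof.
by congr cintegral; apply/funext => z; rewrite hornerXn hornerC conjc1 mulr1.
Qed.

Lemma fourier_coef0 : fourier_coef mu 0 = 1.
Proof.
apply/eqP; rewrite eq_complex /=; apply/andP; split; apply/eqP.
  exact: Rintegral_cst_probability.
exact: Rintegral_cst_probability.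
Qed.

Lemma dirac_of_poly_form (lambda : R[i]) : `|lambda| = 1 ->
  poly_form ('X - lambda%:P) ('X - lambda%:P) = 0 -> is_dirac mu.
Proof.
move=> l1 H.
pose z0 : circle R := exist _ (lambda : R[i]^o) (mem_set (l1 : unit_circle _)).
pose f (z : borel_circle R) : R := complex.Re
  (('X - lambda%:P).[set_val z] * conjc ('X - lambda%:P).[set_val z]).
have [mf _ [M bM]] := bounded_borel_poly_form ('X - lambda%:P) ('X - lambda%:P).
have fE z : f z = complex.Re (set_val z - lambda) ^+ 2 + complex.Im (set_val z - lambda) ^+ 2.
  apply: (@complexI R); rewrite add_Re2_Im2 sqr_normc /f hornerXsubC.
  by rewrite RRe_real// ger0_real// mulcJ_ge0.
have f0 z : 0 <= f z by rewrite fE addr_ge0// sqr_ge0.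
have fz z : z != z0 -> f z != 0.
  apply: contra => /eqP; rewrite fE => /eqP; rewrite paddr_eq0 ?sqr_ge0// !sqrf_eq0.
  move=> /andP[/eqP r0 /eqP i0]; apply/eqP; apply: val_inj => /=.
  by apply/eqP; rewrite -subr_eq0 eq_complex r0 i0/= !eqxx.
have if0 : (\int[mu]_z `|(f z)%:E| = 0)%E.
  under eq_integral do rewrite abse_EFin ger0_norm//.
  have ifin := bounded_borel_integrable (bounded_borel_poly_form ('X - lambda%:P) ('X - lambda%:P)).
  rewrite -[LHS]fineK; last exact: (integrable_fin_num measurableT ifin.1).
  exact: (congr1 EFin (congr1 (@complex.Re R) H)).
have mf' : measurable_fun setT (EFin \o f) by exact/measurable_EFinP.
have /(ae_eq_integral_abs mu measurableT mf')[N [mN N0 subN]] := if0.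
(* The integrand |z - lambda|^2 vanishes outside the null set [N], yet only at [z0]; so any set
   missing [z0] lies in [N]. A measurable set containing [z0] is treated through its complement. *)
have offN A : ~ A z0 -> A `<=` N.
  move=> nA z Az; apply: subN => /= /(_ I) [] /eqP; apply/negP/fz.
  by apply: contra_not_neq nA => <-.
exists z0 => A mA; rewrite diracE; have [Az|nAz] := pselect (A z0).
  rewrite mem_set//= -[A]setCK probability_setC; last exact: measurableC.
  rewrite (_ : mu (~` A) = 0%E) ?sube0//.
  by apply: (@subset_measure0 _ _ _ mu _ N) => //; [exact: measurableC|exact: offN].
rewrite memNset//=; apply: (@subset_measure0 _ _ _ mu _ N) => //; exact: offN.
Qed.

End cintegral.

(** * From eigenvectors to extremal sequences *)

Lemma contraction_extremal (R : realType) (k : nat -> nat) :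
  (forall (H : completeNormedModType R[i]) (dot : {dot H for Num.conj})
     (T : {linear H -> H}) (x : H),
     induces_norm dot -> linear_contraction T -> x != 0 ->
     cesaro_mean (fun n => `|dot (iter (k n) T x) x| ^+ 2) @ \oo
       --> (`|x| ^+ 4 : R[i]^o) ->
     unimodular_eigenvector T x) ->
  wiener_extremal R k.
Proof.
move=> eig mu cv; pose s := poly_semidot mu.
pose T := extension_linear (mulX_lin (R := R)) (mulX_iso mu).
pose x : completion s := embed s 1.
have iterT n : iter n T x = embed s 'X^n.
  elim: n => [|n IH]; first by rewrite expr0.
  by rewrite iterS IH exprS; exact: extension_embed.
(* The constant 1 is a unit vector because [mu] has mass 1, so the limit |x|^4 required of the
   contraction is the limit 1 assumed of the measure. *)
have x2 : `|x| ^+ 2 = 1.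
  rewrite (completion_induces_norm x) completion_dotE cdot_embed /=.
  by rewrite -(expr0 'X) poly_formX fourier_coef0.
have x0 : x != 0.
  by apply/eqP => x0; move/eqP: x2; rewrite x0 normr0 expr0n eq_sym oner_eq0.
have contrT : linear_contraction T := extension_contraction (mulX_lin (R := R)) (mulX_iso mu).
have cvT : cesaro_mean (fun n => `|completion_dot s (iter (k n) T x) x| ^+ 2) @ \oo
    --> (`|x| ^+ 4 : R[i]^o).
  rewrite (_ : `|x| ^+ 4 = 1); last by rewrite (_ : 4 = 2 * 2)%N// exprM x2 expr1n.
  rewrite (_ : cesaro_mean _ = cesaro_mean (fun n => `|fourier_coef mu (k n)| ^+ 2))//.
  congr cesaro_mean; apply/funext => n.
  by rewrite iterT completion_dotE cdot_embed -poly_formX.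
have [_ [lambda l1 Tx]] := eig _ _ T x (completion_induces_norm (s := s)) contrT x0 cvT.
apply: (dirac_of_poly_form l1).
(* The eigenvalue equation T 1 = lambda 1 says that X - lambda is zero in the completion; as [embed]
   preserves inner products, its form against itself vanishes. *)
have : embed s ('X - lambda%:P) = 0.
  rewrite addrC -[lambda%:P]mulr1 mul_polyC -scaleNr embed_lin -/x.
  have := iterT 1%N; rewrite /= expr1 => <-.
  by rewrite Tx scaleNr addNr.
move=> E; have := cdot_embed s ('X - lambda%:P) ('X - lambda%:P); rewrite E => H.
exact: (etrans (esym H) (semidot0l (csemidot s) _)).
Qed.

Unset Implicit Arguments.
Set Strict Implicit.
Set Printing Implicit Defensive.

Theorem theorem5p7 (R : realType) (k : nat -> nat) (hk : nat_subsequence k) :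
  wiener_extremal R k <->
  (forall (H : completeNormedModType R[i]) (dot : {dot H for Num.conj})
     (T : {linear H -> H}) (x : H),
     induces_norm dot -> linear_contraction T -> x != 0 ->
     cesaro_mean (fun n => `|dot (iter (k n) T x) x| ^+ 2) @ \oo
       --> (`|x| ^+ 4 : R[i]^o) ->
     unimodular_eigenvector T x).
Proof.
split; first exact: extremal_contraction.
exact: contraction_extremal.
Qed.
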